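(* Let $\mathcal{G}$ be a class of graphs that is contained in the class of $P_4$-extendible graphs or contained in the class of $P_4$-sparse graphs, and that is closed under taking complements and under taking induced subgraphs. Let $G$ be a graph in $\mathcal{G}$ and let $s\ge 2$ be an integer. Then $G$ is a minimal $(s,1)$-polar obstruction if and only if $G$ satisfies exactly one of the following assertions: (1) $G$ is isomorphic to one of the seven graphs $K_1+2K_2$, $2P_3$, $2K_1+C_4$, $K_1+\overline{P_3+K_2}$, $K_1+C_5$, $K_1+P$, $K_1+\overline{P_5}$. (2) $G$ is isomorphic to one of $2K_{s+1}$, $K_2+(K_s\oplus 2K_1)$, $K_1+(K_{s-1}\oplus C_4)$. (3) The complement $\overline{G}$ is disconnected with connected components $G_1,\dots,G_t$, and there are nonnegative integers $s_1,\dots,s_t$ such that each $G_i$ is a minimal $(1,s_i)$-polar obstruction whose complement $\overline{G_i}$ is not isomorphic to any of the seven graphs in (1), and $s=t-1+\sum_{i=1}^t s_i$.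
   Context: All graphs are simple and finite; graph classes are closed under isomorphism. $G+H$ is disjoint union, $nG$ is the disjoint union of $n$ copies of $G$, $G\oplus H$ is the join $\overline{\overline{G}+\overline{H}}$. $P$ (the banner) is the 5-vertex graph obtained from $C_4$ by attaching one pendant vertex to one vertex of the cycle. For nonnegative integers $s,k$, an $(s,k)$-polar partition of a graph $G$ is a partition $(A,B)$ of its vertex set (parts may be empty) such that $G[A]$ is a complete multipartite graph with at most $s$ parts and $G[B]$ is a disjoint union of at most $k$ complete graphs; $G$ is $(s,k)$-polar if it has such a partition. A minimal $(s,k)$-polar obstruction is a graph that is not $(s,k)$-polar but all of whose proper induced subgraphs are $(s,k)$-polar. ''A $P_4$'' of a graph means an induced path on four vertices. A graph is $P_4$-sparse if every set of five vertices induces at most one $P_4$. A graph is $P_4$-extendible if for every vertex subset $W$ inducing a $P_4$, there is at most one vertex $v\notin W$ that belongs to a $P_4$ sharing vertices with $W$. *)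

(* Defs.v *)
From mathcomp Require Import all_boot.

Set Implicit Arguments.
Unset Strict Implicit.
Unset Printing Implicit Defensive.

Record sgraph := SGraph {
  vertex :> finType;
  adj : rel vertex;
  adj_sym : symmetric adj;
  adj_irrefl : irreflexive adj }.

Definition giso (G H : sgraph) : Prop :=
  exists2 f : G -> H, bijective f & {mono f : x y / adj x y}.

Definition graph_class := sgraph -> Prop.

Definition iso_closed (C : graph_class) : Prop :=
  forall G H : sgraph, giso G H -> C G -> C H.

Section InducedSubgraph.
Variables (G : sgraph) (W : {set G}).

Definition induced_adj : rel {x : G | x \in W} :=
  fun x y => adj (val x) (val y).

Lemma induced_sym : symmetric induced_adj.
Proof. by move=> x y; apply: adj_sym. Qed.

Lemma induced_irrefl : irreflexive induced_adj.
Proof. by move=> x; apply: adj_irrefl. Qed.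

Definition induced : sgraph := SGraph induced_sym induced_irrefl.
End InducedSubgraph.

Section Complement.
Variable G : sgraph.

Definition compl_adj : rel G := fun x y => (x != y) && ~~ adj x y.

Lemma compl_sym : symmetric compl_adj.
Proof. by move=> x y; rewrite /compl_adj eq_sym adj_sym. Qed.

Lemma compl_irrefl : irreflexive compl_adj.
Proof. by move=> x; rewrite /compl_adj eqxx. Qed.

Definition compl : sgraph := SGraph compl_sym compl_irrefl.
End Complement.

Section DisjointUnion.
Variables G H : sgraph.

Definition gsum_adj : rel (G + H)%type := fun u v =>
  match u, v with
  | inl x, inl y => adj x y
  | inr x, inr y => adj x y
  | _, _ => false
  end.

Lemma gsum_sym : symmetric gsum_adj.
Proof. by move=> [x|x] [y|y] //=; apply: adj_sym. Qed.

Lemma gsum_irrefl : irreflexive gsum_adj.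
Proof. by move=> [x|x] /=; apply: adj_irrefl. Qed.

Definition gsum : sgraph := SGraph gsum_sym gsum_irrefl.
End DisjointUnion.

Definition gjoin (G H : sgraph) : sgraph := compl (gsum (compl G) (compl H)).

Section Copies.
Variables (n : nat) (G : sgraph).

Definition copies_adj : rel ('I_n * G)%type := fun u v =>
  (u.1 == v.1) && adj u.2 v.2.

Lemma copies_sym : symmetric copies_adj.
Proof. by move=> u v; rewrite /copies_adj eq_sym adj_sym. Qed.

Lemma copies_irrefl : irreflexive copies_adj.
Proof. by move=> u; rewrite /copies_adj adj_irrefl andbF. Qed.

Definition copies : sgraph := SGraph copies_sym copies_irrefl.
End Copies.

Section NamedGraphs.
Variable n : nat.

Definition K_adj : rel 'I_n := fun i j => i != j.

Lemma K_sym : symmetric K_adj.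
Proof. by move=> i j; rewrite /K_adj eq_sym. Qed.

Lemma K_irrefl : irreflexive K_adj.
Proof. by move=> i; rewrite /K_adj eqxx. Qed.

Definition K_ : sgraph := SGraph K_sym K_irrefl.

Definition P_adj : rel 'I_n := fun i j =>
  (i.+1 == j :> nat) || (j.+1 == i :> nat).

Lemma P_sym : symmetric P_adj.
Proof. by move=> i j; rewrite /P_adj orbC. Qed.

Lemma P_irrefl : irreflexive P_adj.
Proof. by move=> i; rewrite /P_adj orbb gtn_eqF. Qed.

Definition P_ : sgraph := SGraph P_sym P_irrefl.

(* This is the n-cycle only for n >= 3. *)
Definition C_adj : rel 'I_n := fun i j =>
  (i != j) && ((ordS i == j) || (ordS j == i)).

Lemma C_sym : symmetric C_adj.
Proof. by move=> i j; rewrite /C_adj eq_sym orbC. Qed.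

Lemma C_irrefl : irreflexive C_adj.
Proof. by move=> i; rewrite /C_adj eqxx. Qed.

Definition C_ : sgraph := SGraph C_sym C_irrefl.
End NamedGraphs.

Section Pendant.
Variables (G : sgraph) (v : G).

(* [None] is the new vertex, adjacent to [v] only. *)
Definition pendant_adj : rel (option G) := fun x y =>
  match x, y with
  | Some a, Some b => adj a b
  | Some a, None | None, Some a => a == v
  | None, None => false
  end.

Lemma pendant_sym : symmetric pendant_adj.
Proof. by move=> [x|] [y|] //=; apply: adj_sym. Qed.

Lemma pendant_irrefl : irreflexive pendant_adj.
Proof. by move=> [x|] //=; apply: adj_irrefl. Qed.

Definition pendant : sgraph := SGraph pendant_sym pendant_irrefl.
End Pendant.

Definition banner : sgraph := @pendant (C_ 4) ord0.

Definition is_P4 (G : sgraph) (W : {set G}) : Prop := giso (induced W) (P_ 4).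

Definition P4_sparse (G : sgraph) : Prop :=
  forall S W1 W2 : {set G}, #|S| = 5 ->
    W1 \subset S -> W2 \subset S -> is_P4 W1 -> is_P4 W2 -> W1 = W2.

Definition in_P4_meeting (G : sgraph) (W : {set G}) (v : G) : Prop :=
  exists X : {set G}, [/\ is_P4 X, v \in X & X :&: W != set0].

Definition P4_extendible (G : sgraph) : Prop :=
  forall W : {set G}, is_P4 W ->
  forall v1 v2 : G, v1 \notin W -> v2 \notin W ->
    in_P4_meeting W v1 -> in_P4_meeting W v2 -> v1 = v2.

Definition compl_closed (C : graph_class) : Prop :=
  forall G : sgraph, C G -> C (compl G).

Definition induced_closed (C : graph_class) : Prop :=
  forall (G : sgraph) (W : {set G}), C G -> C (induced W).

(* The blocks of [partition] are nonempty, so the graph without vertices has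
   zero parts. *)
Definition complete_multipartite (s : nat) (G : sgraph) : Prop :=
  exists P : {set {set G}}, [/\ partition P [set: G], #|P| <= s &
    forall x y : G, adj x y = (pblock P x != pblock P y)].

Definition cluster (k : nat) (G : sgraph) : Prop :=
  exists P : {set {set G}}, [/\ partition P [set: G], #|P| <= k &
    forall x y : G, adj x y = (x != y) && (pblock P x == pblock P y)].

Definition polar (s k : nat) (G : sgraph) : Prop :=
  exists A : {set G},
    complete_multipartite s (induced A) /\ cluster k (induced (~: A)).

Definition min_polar_obstruction (s k : nat) (G : sgraph) : Prop :=
  ~ polar s k G /\
  forall W : {set G}, W \proper [set: G] -> polar s k (induced W).

Definition components (G : sgraph) : {set {set G}} :=
  equivalence_partition (connect (@adj G)) [set: G].

Definition sporadic (G : sgraph) : Prop :=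
  giso G (gsum (K_ 1) (copies 2 (K_ 2))) \/
  giso G (copies 2 (P_ 3)) \/
  giso G (gsum (copies 2 (K_ 1)) (C_ 4)) \/
  giso G (gsum (K_ 1) (compl (gsum (P_ 3) (K_ 2)))) \/
  giso G (gsum (K_ 1) (C_ 5)) \/
  giso G (gsum (K_ 1) banner) \/
  giso G (gsum (K_ 1) (compl (P_ 5))).

Definition disconnected_type (s : nat) (G : sgraph) : Prop :=
  giso G (copies 2 (K_ s.+1)) \/
  giso G (gsum (K_ 2) (gjoin (K_ s) (copies 2 (K_ 1)))) \/
  giso G (gsum (K_ 1) (gjoin (K_ (s - 1)) (C_ 4))).

(* [sigma] assigns the number s_i to the component G_i of the complement. *)
Definition join_type (s : nat) (G : sgraph) : Prop :=
  1 < #|components (compl G)| /\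
  exists sigma : {set compl G} -> nat,
    (forall D : {set compl G}, D \in components (compl G) ->
       min_polar_obstruction 1 (sigma D) (induced D) /\
       ~ sporadic (compl (induced D))) /\
    s = #|components (compl G)| - 1 + \sum_(D in components (compl G)) sigma D.

Definition exactly_one (A B C : Prop) : Prop :=
  [/\ [\/ A, B | C], ~ (A /\ B), ~ (A /\ C) & ~ (B /\ C)].

(* Main.v *)
(* Passing to complements turns a (1,k)-polar partition of H into a (k,1)-polar
   partition of its complement, so all the pieces of G are compared inside G.

   If G is disconnected, a clique and a complete multipartite part that is not
   stable each live in one component, which makes polarity explicit; the
   forbidden subgraphs of split graphs (2K_2, C_4, C_5) then lead to (1) or (2).
   The P_4-structure plays no role here.

   If the complement of G is disconnected, the least k for which a set is
   (k,1)-polar is additive over the co-components. A minimal (k,1)-polar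
   obstruction whose complement is connected is (k+1,1)-polar unless it is
   sporadic, and this gives (3).

   If G and its complement are connected, G is not split, hence contains C_5, or
   it or its complement contains 2K_2. In a P_4-extendible graph a C_5 is a
   module, and P_4-sparse graphs have none. Growing the 2K_2 yields a module
   containing a 2K_2, which is proper unless G or its complement is made of a
   P_5 or co-banner and the vertices seeing exactly two fixed vertices of it. A
   proper module lies far from two non-adjacent vertices, so that G would
   properly contain a sporadic graph; the exceptional shape contains one as
   well, or is (2,1)-polar. *)

Require Import Defs.
From mathcomp Require Import all_boot zify.

Set Implicit Arguments.
Unset Strict Implicit.
Unset Printing Implicit Defensive.

(** * Polarity of vertex subsets *)

(** The seven graphs of (1) are not (k,1)-polar for any k, and deleting any vertex makes them
    (2,1)-polar. An embedding of one of them into a minimal (s,1)-obstruction is therefore onto; as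
    all seven are disconnected, none embeds in a connected obstruction. Almost every configuration
    met below is identified or discarded in this way.

    The same fact explains the exclusion in (3). A co-component that is a minimal (k,1)-obstruction
    and also (k+1,1)-polar has least value k+1, while a sporadic one has no least value. In a
    minimal obstruction the t least values add up to s+1, which is the equation s = t-1 + sum s_i.
    That k+1 parts are enough is read off from 2K_1 for k = 0 and from 2K_2, C_4, C_5 for k = 1. For
    larger k it comes from the list in (2), because a co-component has a connected complement and,
    if it were connected too, could not be an obstruction. *)

Lemma index_enum_inj (T : finType) (A : {set T}) :
  {in A &, injective (fun x => index x (enum A))}.
Proof.
move=> x y xA yA /(congr1 (nth x (enum A))).
by rewrite !nth_index ?mem_enum.
Qed.

Section SetPolarity.
Variable G : sgraph.
Implicit Types (x y z : G) (A B W : {set G}).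

Definition clique B := [forall x in B, forall y in B, (x != y) ==> adj x y].

(** Non-adjacency is transitive on [A]: no three vertices of [A] induce [K_1 + K_2]. *)
Definition multipartite A :=
  [forall x in A, forall y in A, forall z in A, adj x z ==> adj x y || adj y z].

Definition nonnbrs A x := [set y in A | ~~ adj x y].

(* For multipartite [A] the sets [nonnbrs A x] are the parts. *)
Definition nparts A := #|nonnbrs A @: A|.

(** A boolean on vertex subsets: minimality can then be discussed inside one vertex set, without
    induced subgraphs of induced subgraphs. *)
Definition spolar s W := [exists A : {set G},
  [&& A \subset W, multipartite A, nparts A <= s & clique (W :\: A)]].

Lemma cliqueP B :
  reflect {in B &, forall x y, x != y -> adj x y} (clique B).
Proof.
apply: (iffP forall_inP) => [h x y xB yB|h x xB].
  by move/implyP: (forall_inP (h x xB) y yB).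
by apply/forall_inP => y yB; apply/implyP; apply: h.
Qed.

Lemma multipartiteP A :
  reflect {in A & &, forall x y z, adj x z -> adj x y || adj y z}
          (multipartite A).
Proof.
apply: (iffP forall_inP) => [h x y z xA yA zA|h x xA].
  by move/implyP: (forall_inP (forall_inP (h x xA) y yA) z zA).
by apply/forall_inP => y yA; apply/forall_inP => z zA; apply/implyP; apply: h.
Qed.

Lemma mem_nonnbrs A x y : (y \in nonnbrs A x) = (y \in A) && ~~ adj x y.
Proof. by rewrite inE. Qed.

Lemma nonnbrs_eq A x y : multipartite A -> x \in A -> y \in A ->
  (nonnbrs A x == nonnbrs A y) = ~~ adj x y.
Proof.
move=> /multipartiteP mA xA yA; apply/eqP/idP => [E|nxy].
  have: y \in nonnbrs A y by rewrite mem_nonnbrs yA adj_irrefl.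
  by rewrite -E mem_nonnbrs => /andP[].
apply/setP => z; rewrite !mem_nonnbrs; case zA: (z \in A) => //=; congr (~~ _).
apply/idP/idP => [xz|yz].
  by have := mA _ _ _ xA yA zA xz; rewrite (negPf nxy).
by have := mA _ _ _ yA xA zA yz; rewrite adj_sym (negPf nxy).
Qed.

Lemma coloringP s A :
  reflect (exists2 f : G -> nat, {in A, forall x, f x < s} &
             {in A &, forall x y, adj x y = (f x != f y)})
          (multipartite A && (nparts A <= s)).
Proof.
apply: (iffP andP) => [[mA pA]|[f fs fA]].
  exists (fun x => index (nonnbrs A x) (enum (nonnbrs A @: A))) => [x xA|x y xA yA].
    apply: leq_trans pA; rewrite /nparts cardE index_mem mem_enum.
    exact: imset_f.
  apply/idP/idP => [xy|].
    apply/eqP => /index_enum_inj => /(_ (imset_f _ xA) (imset_f _ yA))/eqP.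
    by rewrite nonnbrs_eq // xy.
  by apply: contraNT; rewrite -(nonnbrs_eq mA xA yA) => /eqP ->.
split.
  apply/multipartiteP => x y z xA yA zA; rewrite !fA //.
  by case: (f x =P f y) => // ->.
(* Every part is a fibre of [f] on [A], and [f] takes at most [s] values there. *)
pose g (i : 'I_s) := [set y in A | i == f y :> nat].
apply: (leq_trans (subset_leq_card (B := mem (g @: setT)) _)); last first.
  by apply: leq_trans (leq_imset_card _ _) _; rewrite cardsT card_ord.
apply/subsetP => _ /imsetP[x xA ->]; apply/imsetP.
exists (Ordinal (fs x xA)) => //; apply/setP => y; rewrite !inE.
by case yA: (y \in A) => //=; rewrite fA // negbK.
Qed.

(* Colours [>= s] mark the clique side of the partition. *)
Lemma spolarP s W :
  reflect (exists2 f : G -> nat,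
             {in W &, forall x y, f x < s -> f y < s -> adj x y = (f x != f y)} &
             {in W &, forall x y, s <= f x -> s <= f y -> x != y -> adj x y})
          (spolar s W).
Proof.
apply: (iffP existsP) => [[A /and4P[/subsetP AW mA pA /cliqueP cW]]|[f fA fB]].
  have /coloringP[f fs fA] : multipartite A && (nparts A <= s) by rewrite mA.
  exists (fun x => if x \in A then f x else s) => x y xW yW.
    by case: ifP => xA; case: ifP => yA; rewrite ?ltnn // => _ _; apply: fA.
  case: ifP => xA; first by rewrite leqNgt fs.
  case: ifP => yA; first by rewrite [s <= f y]leqNgt fs.
  by move=> _ _; apply: cW; rewrite inE ?xA ?yA.
exists [set x in W | f x < s].
set A := [set _ in _ | _].
have /andP[-> ->] : multipartite A && (nparts A <= s).
  apply/coloringP; exists f => [x|x y]; first by rewrite inE => /andP[].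
  by rewrite !inE => /andP[xW xs] /andP[yW ys]; apply: fA.
rewrite /=; apply/andP; split; first by apply/subsetP => x; rewrite inE => /andP[].
apply/cliqueP => x y; rewrite !inE.
case xW: (x \in W); rewrite ?andbF //= andbT -leqNgt => xs.
case yW: (y \in W); rewrite ?andbF //= andbT -leqNgt => ys.
exact: fB.
Qed.

Lemma spolar_sub s W W' : W' \subset W -> spolar s W -> spolar s W'.
Proof.
move=> /subsetP sW /spolarP[f fA fB]; apply/spolarP; exists f => x y xW yW.
  by apply: fA; apply: sW.
by apply: fB; apply: sW.
Qed.

Lemma spolar_leq s s' W : s <= s' -> spolar s W -> spolar s' W.
Proof.
move=> ss' /existsP[A /and4P[AW mA pA cW]]; apply/existsP; exists A.
by rewrite AW mA cW (leq_trans pA).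
Qed.
End SetPolarity.

Section Embedding.
Variables (F G : sgraph) (f : F -> G).
Hypotheses (f_inj : injective f) (f_adj : {mono f : x y / adj x y}).

Lemma spolar_emb s (W : {set F}) : spolar s (f @: W) = spolar s W.
Proof.
apply/spolarP/spolarP => [[c cA cB]|[c cA cB]].
  exists (c \o f) => x y xW yW /=; rewrite -f_adj.
    by apply: cA; apply: imset_f.
  by rewrite -(inj_eq f_inj); apply: cB; apply: imset_f.
(* The default 0 is taken only outside the image of [f], where the colouring is never consulted. *)
pose c' y := if [pick x | f x == y] is Some x then c x else 0.
have c'f x : c' (f x) = c x.
  by rewrite /c'; case: pickP => [z /eqP/f_inj->//|/(_ x)]; rewrite eqxx.
exists c' => _ _ /imsetP[x xW ->] /imsetP[y yW ->]; rewrite !c'f f_adj.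
  exact: cA.
by rewrite (inj_eq f_inj); apply: cB.
Qed.
End Embedding.

(** Serves both sides of a polar partition: [r] is non-adjacency on the multipartite side, and
    equality or adjacency on the cluster side. *)
Lemma blocksP (T : finType) (r : rel T) s :
  (exists P : {set {set T}}, [/\ partition P [set: T], #|P| <= s &
     forall x y, r x y = (pblock P x == pblock P y)]) <->
  (exists2 f : T -> nat, forall x, f x < s & forall x y, r x y = (f x == f y)).
Proof.
split=> [[P [pP Ps rP]]|[f fs rf]].
  have inP x : pblock P x \in P by apply: pblock_mem; rewrite (cover_partition pP).
  exists (fun x => index (pblock P x) (enum P)) => [x|x y].
    by apply: leq_trans Ps; rewrite cardE index_mem mem_enum.
  rewrite rP; apply/eqP/eqP => [->//|].
  exact: index_enum_inj.
exists (preim_partition f setT); have pP := preim_partitionP f [set: T].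
split=> //; last first.
  move=> x y; rewrite rf eq_pblock ?(cover_partition pP) //; last first.
    by case/and3P: pP.
  by rewrite pblock_equivalence_partition // => ? ? ? ? ? ? /=; split=> // /eqP->.
pose g (i : 'I_s) := [set y | i == f y :> nat].
apply: (leq_trans (subset_leq_card (B := mem (g @: setT)) _)); last first.
  by apply: leq_trans (leq_imset_card _ _) _; rewrite cardsT card_ord.
apply/subsetP => _ /imsetP[x _ ->]; apply/imsetP.
by exists (Ordinal (fs x)) => //; apply/setP => y; rewrite !inE.
Qed.

Lemma polar_coloring s k (G : sgraph) : polar s k G <->
  exists (A : {set G}) (f g : G -> nat),
   [/\ {in A, forall x, f x < s}, {in A &, forall x y, adj x y = (f x != f y)},
       {in ~: A, forall x, g x < k} &
       {in ~: A &, forall x y, adj x y = (x != y) && (g x == g y)}].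
Proof.
have lift (B : {set G}) (h : induced B -> nat) :
    exists h' : G -> nat, forall u : induced B, h' (val u) = h u.
  exists (fun x => if insub x is Some u then h u else 0) => u.
  by rewrite valK.
split=> [[A [[P [pP Ps aP]] [Q [pQ Qk aQ]]]]|[A [f [g [fs fA gk gB]]]]].
  have /blocksP[f fs af] : exists P : {set {set induced A}},
      [/\ partition P [set: _], #|P| <= s &
       forall x y : induced A, (fun x y => ~~ adj x y) x y = (pblock P x == pblock P y)].
    by exists P; split=> // x y; rewrite aP negbK.
  have /blocksP[g gk ag] : exists P : {set {set induced (~: A)}},
      [/\ partition P [set: _], #|P| <= k & forall x y : induced (~: A),
       (fun x y => (x == y) || adj x y) x y = (pblock P x == pblock P y)].
    exists Q; split=> // x y; rewrite aQ.
    by case: (x =P y) => [->|]; rewrite ?eqxx.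
  have [f' ff'] := lift _ f; have [g' gg'] := lift _ g.
  exists A, f', g'; split.
  - by move=> x xA; have := ff' (exist _ x xA); rewrite /= => ->.
  - move=> x y xA yA; have := af (exist _ x xA) (exist _ y yA).
    by rewrite -!ff' /= => <-; rewrite negbK.
  - by move=> x xA; have := gg' (exist _ x xA); rewrite /= => ->.
  - move=> x y xA yA; have := ag (exist _ x xA) (exist _ y yA).
    rewrite -!gg' /= => <-; rewrite -val_eqE /=.
    rewrite /induced_adj /=; case: (x =P y) => [->|] //=.
    by rewrite adj_irrefl.
exists A; split.
  have [|P [pP Ps aP]] := (blocksP (fun x y : induced A => ~~ adj x y) s).2.
    exists (f \o val) => [x|x y] /=; first by apply: fs; apply: valP.
    by rewrite /induced_adj fA ?negbK //; apply: valP.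
  by exists P; split=> // x y; rewrite -aP negbK.
have [|P [pP Ps aP]] :=
    (blocksP (fun x y : induced (~: A) => (x == y) || adj x y) k).2.
  exists (g \o val) => [x|x y] /=; first by apply: gk; apply: valP.
  rewrite /induced_adj gB; try exact: valP.
  by rewrite val_eqE; case: (x =P y) => [->|]; rewrite ?eqxx.
exists P; split=> // x y; rewrite -aP.
by case: (x =P y) => [->|]; rewrite ?adj_irrefl.
Qed.

Lemma polar_spolar s (G : sgraph) : polar s 1 G <-> spolar s [set: G].
Proof.
split=> [/polar_coloring[A [f [g [fs fA gk gB]]]]|/spolarP[f fA fB]].
  apply/spolarP; exists (fun x => if x \in A then f x else s) => x y _ _.
    by case: ifP => xA; case: ifP => yA; rewrite ?ltnn // => _ _; apply: fA.
  case: ifP => xA; first by rewrite leqNgt fs.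
  case: ifP => yA; first by rewrite [s <= f y]leqNgt fs.
  move=> _ _ xy; rewrite gB ?inE ?xA ?yA // xy /=.
  have := gk x; have := gk y; rewrite !inE xA yA !ltnS !leqn0.
  by move=> /(_ isT)/eqP-> /(_ isT)/eqP->.
apply/polar_coloring; exists [set x | f x < s], f, (fun=> 0); split => //.
- by move=> x; rewrite inE.
- by move=> x y; rewrite !inE; apply: fA.
move=> x y; rewrite !inE -!leqNgt andbT => xs ys.
case: eqP => [->|/eqP xy]; first by rewrite adj_irrefl.
exact: fB.
Qed.

Lemma polar_spolar_compl s (G : sgraph) :
  polar 1 s G <-> spolar s [set: compl G].
Proof.
split=> [/polar_coloring[A [f [g [fs fA gk gB]]]]|/spolarP[f fA fB]].
  apply/spolarP; exists (fun x => if x \in A then s else g x) => x y _ _.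
    case: ifP => xA; rewrite ?ltnn //; case: ifP => yA; rewrite ?ltnn // => _ _.
    rewrite /= /compl_adj gB ?inE ?xA ?yA //.
    by case: (x =P y) => [->|]; rewrite ?eqxx.
  case: ifP => xA; last by rewrite leqNgt gk // inE xA.
  case: ifP => yA; last by rewrite [s <= g y]leqNgt gk // inE yA.
  move=> _ _ xy; rewrite /= /compl_adj xy fA // negbK.
  have := fs x; have := fs y; rewrite xA yA !ltnS !leqn0.
  by move=> /(_ isT)/eqP-> /(_ isT)/eqP->.
apply/polar_coloring; exists [set x | s <= f x], (fun=> 0), f; split => //.
- move=> x y; rewrite !inE => xs ys; rewrite eqxx /=.
  case: (x =P y) => [->|/eqP xy]; first by rewrite adj_irrefl.
  by have := fB x y (in_setT _) (in_setT _) xs ys xy; rewrite /= /compl_adj xy => /negPf.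
- by move=> x; rewrite !inE -ltnNge.
move=> x y; rewrite !inE -!ltnNge => xs ys.
have := fA x y (in_setT _) (in_setT _) xs ys; rewrite /= /compl_adj.
by case: (x =P y) => [->|_] /=; rewrite ?adj_irrefl // => /negbRL; rewrite negbK.
Qed.

(** * Embeddings and the seven sporadic graphs *)

Lemma spolar_induced s (G : sgraph) (W : {set G}) :
  spolar s [set: induced W] = spolar s W.
Proof.
rewrite -(@spolar_emb _ _ (val : induced W -> G) val_inj); last by [].
congr spolar; apply/setP => x; apply/imsetP/idP => [[u _ ->]|xW]; first exact: valP.
by exists (exist _ x xW).
Qed.

Lemma polar_induced s (G : sgraph) (W : {set G}) :
  polar s 1 (induced W) <-> spolar s W.
Proof. by rewrite polar_spolar spolar_induced. Qed.

(** Deleting one vertex at a time is enough, because [spolar] passes to subsets. *)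
Definition min_spolar_obs (G : sgraph) s (W : {set G}) :=
  ~~ spolar s W && [forall v in W, spolar s (W :\ v)].

Lemma min_spolar_obsP (G : sgraph) s (W : {set G}) :
  reflect (~ spolar s W /\ forall W' : {set G}, W' \proper W -> spolar s W')
          (min_spolar_obs s W).
Proof.
apply: (iffP andP) => [[/negP nW /forall_inP dW]|[/negP nW pW]].
  split=> // W' /properP[sW' [v vW vW']].
  by apply: spolar_sub (dW v vW); rewrite subsetD1 sW'.
by split=> //; apply/forall_inP => v vW; apply: pW; rewrite properD1.
Qed.

Lemma min_polar_obstructionP s (G : sgraph) :
  min_polar_obstruction s 1 G <-> min_spolar_obs s [set: G].
Proof.
split=> [[nG pG]|/min_spolar_obsP[nG pG]].
  apply/min_spolar_obsP; split=> [/polar_spolar//|W /pG].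
  by move/polar_induced.
by split=> [/polar_spolar//|W /pG ?]; apply/polar_induced.
Qed.

Lemma min_polar_obstruction_compl s (H : sgraph) :
  min_polar_obstruction 1 s H <-> min_spolar_obs s [set: compl H].
Proof.
have ind (W : {set H}) : polar 1 s (induced W) <-> spolar s (W : {set compl H}).
  rewrite polar_spolar_compl -(@spolar_induced s (compl H) W).
  have -> // : spolar s [set: compl (induced W)] =
      spolar s [set: @induced (compl H) W].
  rewrite -(@spolar_emb (compl (induced W)) (@induced (compl H) W) id) //.
    by congr spolar; apply/setP => x; rewrite imset_id.
split=> [[nG pG]|/min_spolar_obsP[nG pG]].
  apply/min_spolar_obsP; split=> [/polar_spolar_compl//|W /pG].
  by move/ind.
by split=> [/polar_spolar_compl//|W /pG ?]; apply/ind.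
Qed.

Lemma min_spolar_obs_emb (F G : sgraph) (f : F -> G) s (W : {set F}) :
  injective f -> {mono f : x y / adj x y} ->
  min_spolar_obs s (f @: W) = min_spolar_obs s W.
Proof.
move=> fi fa; rewrite /min_spolar_obs (spolar_emb fi fa); congr (_ && _).
have fD v : f @: W :\ f v = f @: (W :\ v).
  apply/setP => y; rewrite !inE; apply/andP/imsetP.
    by move=> [yv /imsetP[x xW ?]]; subst y; exists x; rewrite // !inE -(inj_eq fi) yv.
  by move=> [x /setD1P[xv xW] ->]; rewrite (inj_eq fi) xv imset_f.
apply/forall_inP/forall_inP => [h v vW|h _ /imsetP[v vW ->]].
  by have := h _ (imset_f f vW); rewrite fD (spolar_emb fi fa).
by rewrite fD (spolar_emb fi fa); apply: h.
Qed.

(** Assertion (3) takes its pieces in the complement and asks for (1,k)-polarity there.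
    Complementing such a piece gives back the adjacency of [G] on [D], where the condition reads
    (k,1). *)
Lemma min_spolar_obs_compl_induced s (G : sgraph) (D : {set G}) :
  min_spolar_obs s [set: compl (@induced (compl G) D)] = min_spolar_obs s D.
Proof.
rewrite -(@min_spolar_obs_emb _ G (val : compl (@induced (compl G) D) -> G)).
- congr min_spolar_obs; apply/setP => x; apply/imsetP/idP => [[u _ ->]|xW].
    exact: valP.
  by exists (exist _ x xW).
- exact: val_inj.
move=> x y; rewrite /= /compl_adj /= /induced_adj /= /compl_adj -val_eqE /=.
by case: eqP => [->|]; rewrite ?adj_irrefl //= negbK.
Qed.

Lemma spolar_compl_induced s (G : sgraph) (D : {set G}) :
  spolar s [set: compl (@induced (compl G) D)] = spolar s D.
Proof.
rewrite -(@spolar_emb _ G (val : compl (@induced (compl G) D) -> G)).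
- congr spolar; apply/setP => x; apply/imsetP/idP => [[u _ ->]|xW].
    exact: valP.
  by exists (exist _ x xW).
- exact: val_inj.
move=> x y; rewrite /= /compl_adj /= /induced_adj /= /compl_adj -val_eqE /=.
by case: eqP => [->|]; rewrite ?adj_irrefl //= negbK.
Qed.

Definition emb (F G : sgraph) : Prop :=
  exists2 f : F -> G, injective f & {mono f : x y / adj x y}.

Lemma giso_emb (G F : sgraph) : giso G F -> emb F G.
Proof.
case=> f [g fK gK] fa; exists g; first exact: can_inj gK.
by move=> x y; rewrite -fa !gK.
Qed.

Lemma emb_spolar s (F G : sgraph) :
  emb F G -> spolar s [set: G] -> spolar s [set: F].
Proof.
by case=> f fi fa pG; rewrite -(spolar_emb fi fa); apply: spolar_sub pG.
Qed.

(** The image of the embedding is not polar, so minimality forces it to be all of [G]. *)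
Lemma emb_giso s (F G : sgraph) : min_spolar_obs s [set: G] ->
  ~ spolar s [set: F] -> emb F G -> giso G F.
Proof.
move=> /min_spolar_obsP[_ pG] nF [f fi fa].
have [/pG|] := boolP (f @: setT \proper setT); first by rewrite (spolar_emb fi fa).
rewrite properE subsetT negbK => /subset_leq_card.
rewrite (card_imset _ fi) !cardsT => /(inj_card_bij fi)[g fK gK].
exists g; first by exists f.
by move=> x y; rewrite -fa !gK.
Qed.

Lemma giso_min_spolar_obs s (F G : sgraph) : giso G F ->
  min_spolar_obs s [set: F] -> min_spolar_obs s [set: G].
Proof.
case=> f [g fK gK] fa; rewrite -(min_spolar_obs_emb s _ (can_inj fK) fa).
by have -> // : f @: setT = setT; apply/setP => x; rewrite !inE -[x]gK imset_f.
Qed.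

(** * Adjacency tables and verification by computation *)

Section Patterns.
Variable G : sgraph.
Implicit Type t : seq G.

(** The strict upper triangle of the adjacency matrix along [t]; an induced copy of a named graph is
    recognised by comparing two lists of booleans. *)
Fixpoint upper t :=
  if t is x :: t' then [seq adj x y | y <- t'] :: upper t' else [::].

Lemma size_upper t : size (upper t) = size t.
Proof. by elim: t => //= x t ->. Qed.

Lemma nth_upper x0 t i j : i < j < size t ->
  nth false (nth [::] (upper t) i) (j - i.+1) = adj (nth x0 t i) (nth x0 t j).
Proof.
elim: t i j => [|x t IH] [|i] [|j] //=; rewrite ?ltnS => h.
- by rewrite ltn0 andbF in h.
- by rewrite subn1 (nth_map x0).
by rewrite subSS IH.
Qed.
End Patterns.

Lemma upper_emb (F G : sgraph) (s : seq F) (x0 : G) (t : seq G) :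
  (forall x, x \in s) -> uniq (x0 :: t) -> upper s = upper (x0 :: t) -> emb F G.
Proof.
set u := x0 :: t => sF uu E.
have sz : size s = size u by rewrite -size_upper E size_upper.
exists (fun x => nth x0 u (index x s)).
  move=> x y /eqP; rewrite nth_uniq -?sz ?index_mem // => /eqP.
  by move/(congr1 (nth x s)); rewrite !nth_index.
have ltadj x y : index x s < index y s ->
    adj (nth x0 u (index x s)) (nth x0 u (index y s)) = adj x y.
  move=> lt; have b : index x s < index y s < size s by rewrite lt index_mem sF.
  have := nth_upper x b; rewrite E (nth_upper x0) -?sz //.
  by rewrite !nth_index.
move=> x y; case: (ltngtP (index x s) (index y s)) => [/ltadj//|/ltadj h|h].
  by rewrite adj_sym h adj_sym.
suff -> : x = y by rewrite !adj_irrefl.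
by have := congr1 (nth x s) h; rewrite !nth_index.
Qed.

Fixpoint words (T : Type) (a : seq T) n :=
  if n is n'.+1 then [seq x :: w | x <- a, w <- words a n'] else [:: [::]].

Lemma mem_words (T : eqType) (a w : seq T) :
  all (mem a) w -> w \in words a (size w).
Proof.
elim: w => //= x w IH /andP[xa /IH wa].
by apply/allpairsP; exists (x, w).
Qed.

Section Computation.
Variables (F : sgraph) (s : seq F).

Definition splits_as (A B : seq F) :=
  all (fun x => all (fun y => all (fun z =>
    adj x z ==> adj x y || adj y z) A) A) A &&
  all (fun x => all (fun y => (x == y) || adj x y) B) B.

(** All divisions into two sides are tried, with no bound on the number of parts, so success
    excludes (k,1)-polarity for every [k] at once. *)
Definition never_polar :=
  all (fun m => ~~ splits_as (mask m s) (mask (map negb m) s))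
      (words [:: true; false] (size s)).

(** Colours 0 and 1 are the two parts and 2 is the clique side, as in [spolarP] with two parts. *)
Definition good_coloring (l : seq F) (cs : seq nat) :=
  let zs := zip l cs in
  all (fun p => all (fun q => (p.1 == q.1) ||
    [&& (p.2 < 2) && (q.2 < 2) ==> (adj p.1 q.1 == (p.2 != q.2)) &
        (2 <= p.2) && (2 <= q.2) ==> adj p.1 q.1]) zs) zs.

Definition two_polar (l : seq F) :=
  has (good_coloring l) (words [:: 0; 1; 2] (size l)).

Hypothesis sF : forall x, x \in s.

Lemma never_polarP k : never_polar -> ~ spolar k [set: F].
Proof.
move=> /allP h /existsP[A /and4P[_ /multipartiteP mA _ /cliqueP cA]].
have /h/negP[] : [seq x \in A | x <- s] \in words [:: true; false] (size s).
  rewrite -(size_map (fun x => x \in A) s); apply: mem_words.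
  by apply/allP => -[].
rewrite -map_comp -!filter_mask; apply/andP; split.
  apply/allP => x; rewrite mem_filter => /andP[xA _].
  apply/allP => y; rewrite mem_filter => /andP[yA _].
  apply/allP => z; rewrite mem_filter => /andP[zA _].
  by apply/implyP; apply: mA.
apply/allP => x; rewrite mem_filter => /andP[xA _].
apply/allP => y; rewrite mem_filter => /andP[yA _].
by case: (x =P y) => //= /eqP; apply: cA; rewrite !inE andbT.
Qed.

Lemma two_polarP (l : seq F) : two_polar l -> spolar 2 [set x in l].
Proof.
move=> /hasP[cs csw /allP good].
have szc : size cs = size l.
  have szw (a : seq nat) n w : w \in words a n -> size w = n.
    elim: n w => [|n IH] w; first by rewrite inE => /eqP->.
    by case/allpairsP => -[x w'] /= [_ /IH <- ->].
  exact: szw csw.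
pose c x := nth 0 cs (index x l).
have inz x : x \in l -> (x, c x) \in zip l cs.
  move=> xl; rewrite -{1}(nth_index x xl) /c -nth_zip //.
  by apply: mem_nth; rewrite size_zip szc minnn index_mem.
apply/spolarP; exists c => x y; rewrite !inE => xl yl.
  case: (x =P y) => [->|/eqP/negPf xy]; first by rewrite adj_irrefl eqxx.
  have /allP/(_ _ (inz y yl)) := good _ (inz x xl); rewrite /= xy /=.
  by case/andP => /implyP h _ cx cy; apply/eqP/h; rewrite cx.
have /allP/(_ _ (inz y yl)) := good _ (inz x xl); rewrite /= => h cx cy /negPf xy.
by move: h; rewrite xy cx cy /= => /andP[_].
Qed.

Definition universal_check := uniq s && never_polar && all (fun v => two_polar (rem v s)) s.

(** Two parts suffice after any deletion, hence also any [k >= 2]; this is why the seven graphs are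
    obstructions for all [s] simultaneously. *)
Lemma universal_checkP : universal_check ->
  (forall k, ~ spolar k [set: F]) /\
  (forall k, 2 <= k -> min_spolar_obs k [set: F]).
Proof.
move=> /andP[/andP[us np] /allP tp].
split=> [k|k k2]; first exact: never_polarP.
apply/andP; split; first by apply/negP/never_polarP.
apply/forall_inP => v _; apply: spolar_leq k2 _.
apply: spolar_sub (two_polarP (tp v (sF v))).
by apply/subsetP => x; rewrite !inE andbT (rem_filter _ us) mem_filter /= sF => ->.
Qed.
End Computation.

Lemma enum_mem (F : finType) (s : seq F) : uniq s -> #|F| <= size s -> forall x, x \in s.
Proof.
move=> us sz x.
have : #|s| >= #|F| by rewrite (card_uniqP us).
have /subset_leqif_card[le eq] : s \subset F by apply/subsetP.
move=> ge; have /eqP : #|s| == #|F| by rewrite eqn_leq le ge.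
by move/eqP; rewrite eq => /subsetP->.
Qed.


(** A non-trivial set that no edge leaves; graphs with at most one vertex count as connected. *)
Definition disc (G : sgraph) := [exists U : {set G},
  [&& U != set0, U != setT & [forall x in U, forall y in ~: U, ~~ adj x y]]].

Lemma discP (G : sgraph) : reflect
  (exists U : {set G}, [/\ exists x, x \in U, exists y, y \notin U &
     forall x y, x \in U -> y \notin U -> ~~ adj x y]) (disc G).
Proof.
apply: (iffP existsP) => [[U /and3P[/set0Pn U0 UT /forall_inP UU]]|[U [U0 [y yU] UU]]].
  exists U; split=> // [|x y xU yU].
    move: UT; rewrite -subTset => /subsetPn[y _ yU]; by exists y.
  by have /forall_inP := UU x xU; apply; rewrite inE.
exists U; apply/and3P; split; first exact/set0Pn.
  by apply: contraNneq yU => ->.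
apply/forall_inP => x xU; apply/forall_inP => z; rewrite inE; exact: UU.
Qed.

Lemma giso_disc (G F : sgraph) : giso G F -> disc F -> disc G.
Proof.
case=> f [g fK gK] fa /discP[U [[x xU] [y yU] UU]].
apply/discP; exists (f @^-1: U); split.
- by exists (g x); rewrite inE gK.
- by exists (g y); rewrite inE gK.
by move=> u v; rewrite !inE -fa; apply: UU.
Qed.

Lemma disc_gsum (F H : sgraph) : F -> H -> disc (gsum F H).
Proof.
move=> x y; apply/discP; exists [set u : gsum F H | if u is inl _ then true else false].
split; [by exists (inl x); rewrite inE|by exists (inr y); rewrite inE|].
by move=> [u|u] [v|v]; rewrite !inE.
Qed.

Lemma disc_copies n (F : sgraph) : F -> disc (copies n.+2 F).
Proof.
move=> x; apply/discP; exists [set u : copies n.+2 F | u.1 == ord0].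
split; [by exists (ord0, x); rewrite inE|by exists (ord_max, x); rewrite inE|].
move=> u v; rewrite !inE /= /copies_adj => /eqP->; rewrite eq_sym.
by move/negPf->.
Qed.

Notation "i %:o n" := (@Ordinal n i isT) (at level 2, n at level 1).

(* Each enumeration starts with the isolated vertices, followed by a largest
   induced cycle in cyclic order, whenever there are any. *)
Definition K1_2K2 := gsum (K_ 1) (copies 2 (K_ 2)).
Definition K1_2K2s : seq K1_2K2 :=
  inl 0%:o 1 :: [seq inr u | u <- [:: (0%:o 2, 0%:o 2); (0%:o 2, 1%:o 2);
                                      (1%:o 2, 0%:o 2); (1%:o 2, 1%:o 2)]].

Definition two_P3 := copies 2 (P_ 3).
Definition two_P3s : seq two_P3 :=
  [seq (i, j) | i <- [:: 0%:o 2; 1%:o 2], j <- [:: 0%:o 3; 1%:o 3; 2%:o 3]].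

Definition C4s := [:: 0%:o 4; 1%:o 4; 2%:o 4; 3%:o 4].
Definition C5s := [:: 0%:o 5; 1%:o 5; 2%:o 5; 3%:o 5; 4%:o 5].

Definition twoK1_C4 := gsum (copies 2 (K_ 1)) (C_ 4).
Definition twoK1_C4s : seq twoK1_C4 :=
  [:: inl (0%:o 2, 0%:o 1), inl (1%:o 2, 0%:o 1) & [seq inr i | i <- C4s]].

Definition K1_coP3K2 := gsum (K_ 1) (compl (gsum (P_ 3) (K_ 2))).
Definition K1_coP3K2s : seq K1_coP3K2 :=
  inl 0%:o 1 :: [seq inr u | u <- [:: inr 0%:o 2; inl 0%:o 3; inr 1%:o 2;
                                      inl 1%:o 3; inl 2%:o 3]].

Definition K1_C5 := gsum (K_ 1) (C_ 5).
Definition K1_C5s : seq K1_C5 := inl 0%:o 1 :: [seq inr i | i <- C5s].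

Definition K1_banner := gsum (K_ 1) banner.
Definition K1_banners : seq K1_banner :=
  inl 0%:o 1 :: [seq inr u | u <- rcons [seq Some i | i <- C4s] None].

Definition K1_coP5 := gsum (K_ 1) (compl (P_ 5)).
Definition K1_coP5s : seq K1_coP5 :=
  inl 0%:o 1 :: [seq inr u | u <- [:: 0%:o 5; 3%:o 5; 1%:o 5; 4%:o 5; 2%:o 5]].

Lemma card_gsum (F H : sgraph) : #|gsum F H| = #|F| + #|H|.
Proof. exact: card_sum. Qed.

Lemma card_copies n (F : sgraph) : #|copies n F| = n * #|F|.
Proof. by rewrite card_prod card_ord. Qed.

Lemma card_banner : #|banner| = 5.
Proof. by rewrite card_option card_ord. Qed.

Lemma card_K n : #|K_ n| = n. Proof. exact: card_ord. Qed.
Lemma card_P n : #|P_ n| = n. Proof. exact: card_ord. Qed.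
Lemma card_C n : #|C_ n| = n. Proof. exact: card_ord. Qed.
Lemma card_compl (F : sgraph) : #|compl F| = #|F|. Proof. by []. Qed.

Definition card_graph :=
  (card_gsum, card_copies, card_banner, card_K, card_P, card_C, card_compl).

Lemma check_K1_2K2 : universal_check K1_2K2s. Proof. by vm_compute. Qed.
Lemma check_two_P3 : universal_check two_P3s. Proof. by vm_compute. Qed.
Lemma check_twoK1_C4 : universal_check twoK1_C4s. Proof. by vm_compute. Qed.
Lemma check_K1_coP3K2 : universal_check K1_coP3K2s. Proof. by vm_compute. Qed.
Lemma check_K1_C5 : universal_check K1_C5s. Proof. by vm_compute. Qed.
Lemma check_K1_banner : universal_check K1_banners. Proof. by vm_compute. Qed.
Lemma check_K1_coP5 : universal_check K1_coP5s. Proof. by vm_compute. Qed.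

Lemma universal_giso (G F : sgraph) (s : seq F) :
  universal_check s -> #|F| <= size s -> giso G F ->
  (forall k, ~ spolar k [set: G]) /\
  (forall k, 2 <= k -> min_spolar_obs k [set: G]).
Proof.
move=> chk sz GF; have us : uniq s by case/andP: chk => /andP[].
have [nF mF] := universal_checkP (enum_mem us sz) chk.
split=> [k /(emb_spolar (giso_emb GF))|k k2]; first exact: nF.
exact: giso_min_spolar_obs GF (mF k k2).
Qed.

Lemma sporadic_universal (G : sgraph) : sporadic G ->
  (forall k, ~ spolar k [set: G]) /\
  (forall k, 2 <= k -> min_spolar_obs k [set: G]).
Proof.
case=> [|[|[|[|[|[|]]]]]].
- by apply: (universal_giso check_K1_2K2); rewrite !card_graph.
- by apply: (universal_giso check_two_P3); rewrite !card_graph.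
- by apply: (universal_giso check_twoK1_C4); rewrite !card_graph.
- by apply: (universal_giso check_K1_coP3K2); rewrite !card_graph.
- by apply: (universal_giso check_K1_C5); rewrite !card_graph.
- by apply: (universal_giso check_K1_banner); rewrite !card_graph.
- by apply: (universal_giso check_K1_coP5); rewrite !card_graph.
Qed.

Lemma sporadic_disc (G : sgraph) : sporadic G -> disc G.
Proof.
case=> [|[|[|[|[|[|]]]]]] /giso_disc; apply.
- exact: (disc_gsum (ord0 : K_ 1) ((ord0, ord0) : copies 2 (K_ 2))).
- exact: disc_copies (ord0 : P_ 3).
- exact: (disc_gsum ((ord0, ord0) : copies 2 (K_ 1)) (ord0 : C_ 4)).
- exact: (disc_gsum (ord0 : K_ 1) (inr ord0 : compl (gsum (P_ 3) (K_ 2)))).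
- exact: (disc_gsum (ord0 : K_ 1) (ord0 : C_ 5)).
- exact: (disc_gsum (ord0 : K_ 1) (None : banner)).
- exact: (disc_gsum (ord0 : K_ 1) (ord0 : compl (P_ 5))).
Qed.

Definition sporadic_tables :=
  [:: upper K1_2K2s; upper two_P3s; upper twoK1_C4s; upper K1_coP3K2s;
      upper K1_C5s; upper K1_banners; upper K1_coP5s].

(** The list [t] spans an induced copy of one of the seven graphs; being polar for no number of
    parts, the copy exhausts the minimal obstruction. *)
Lemma sporadic_match k (G : sgraph) (t : seq G) : min_spolar_obs k [set: G] ->
  uniq t -> upper t \in sporadic_tables -> sporadic G.
Proof.
move=> mG ut.
have conv (F : sgraph) (s : seq F) : universal_check s -> #|F| <= size s ->
    0 < size s -> upper t = upper s -> giso G F.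
  move=> chk sz s0 E; have us : uniq s by case/andP: chk => /andP[].
  have sF := enum_mem us sz; apply: (emb_giso mG).
    by have [] := universal_checkP sF chk.
  case: t ut E => [_ /(congr1 size)|x0 t ut E]; last exact: upper_emb (esym E).
  by rewrite !size_upper => E; rewrite -E in s0.
rewrite !inE => /or4P[||| /or4P[]] /eqP E.
- by left; apply: conv check_K1_2K2 _ _ E; rewrite ?card_graph.
- by right; left; apply: conv check_two_P3 _ _ E; rewrite ?card_graph.
- by do 2!right; left; apply: conv check_twoK1_C4 _ _ E; rewrite ?card_graph.
- by do 3!right; left; apply: conv check_K1_coP3K2 _ _ E; rewrite ?card_graph.
- by do 4!right; left; apply: conv check_K1_C5 _ _ E; rewrite ?card_graph.
- by do 5!right; left; apply: conv check_K1_banner _ _ E; rewrite ?card_graph.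
- by do 6!right; apply: conv check_K1_coP5 _ _ E; rewrite ?card_graph.
Qed.

(** * The three disconnected families *)

Lemma pigeonhole s (f : 'I_s.+1 -> nat) :
  (forall i, f i < s) -> injective f -> False.
Proof.
move=> fs fi; pose g i := Ordinal (fs i).
have gi : injective g by move=> i j [] /fi.
by have := leq_card g gi; rewrite !card_ord ltnn.
Qed.

Section Join.
Variables F H : sgraph.

Lemma gjoin_ll (x y : F) : adj (inl x : gjoin F H) (inl y : gjoin F H) = adj x y.
Proof.
rewrite /= /compl_adj /= /compl_adj (inj_eq inl_inj).
by case: eqP => [->|]; rewrite ?adj_irrefl //= negbK.
Qed.

Lemma gjoin_rr (x y : H) : adj (inr x : gjoin F H) (inr y : gjoin F H) = adj x y.
Proof.
rewrite /= /compl_adj /= /compl_adj (inj_eq inr_inj).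
by case: eqP => [->|]; rewrite ?adj_irrefl //= negbK.
Qed.

Lemma gjoin_lr (x : F) (y : H) : adj (inl x : gjoin F H) (inr y : gjoin F H).
Proof. by []. Qed.

Lemma gjoin_rl (x : F) (y : H) : adj (inr y : gjoin F H) (inl x : gjoin F H).
Proof. by []. Qed.

Definition gjoinE := (gjoin_ll, gjoin_rr, gjoin_lr, gjoin_rl).
End Join.

Section Sum.
Variables F H : sgraph.

Lemma gsum_ll (x y : F) : adj (inl x : gsum F H) (inl y : gsum F H) = adj x y.
Proof. by []. Qed.

Lemma gsum_rr (x y : H) : adj (inr x : gsum F H) (inr y : gsum F H) = adj x y.
Proof. by []. Qed.

Lemma gsum_lr (x : F) (y : H) :
  adj (inl x : gsum F H) (inr y : gsum F H) = false.
Proof. by []. Qed.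

Lemma gsum_rl (x : F) (y : H) :
  adj (inr y : gsum F H) (inl x : gsum F H) = false.
Proof. by []. Qed.

Definition gsumE := (gsum_ll, gsum_rr, gsum_lr, gsum_rl).
End Sum.

Lemma copies_K1 n (x y : copies n (K_ 1)) : adj x y = false.
Proof. by rewrite /= /copies_adj /= /K_adj !ord1 andbF. Qed.

Lemma C4_odd (x y : C_ 4) : adj x y = (odd x != odd y).
Proof. by case: x y => [[|[|[|[|?]]]] ?] [[|[|[|[|?]]]] ?]. Qed.

Lemma ord2_eq (a b j : 'I_2) : a != j -> b != j -> a = b.
Proof.
by case: a b j => [[|[|?]] ?] [[|[|?]] ?] [[|[|?]] ?] // _ _; apply: val_inj.
Qed.

(** Deleting the only vertex of colour [i] frees that colour; colour [s] moves there, so that the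
    colours below [s] suffice. *)
Definition recolor (s i k : nat) := if k == s then i else k.

Lemma recolor_neq s i k l : k != i -> l != i ->
  (recolor s i k != recolor s i l) = (k != l).
Proof. by rewrite /recolor; case: (k =P s); case: (l =P s); lia. Qed.

Lemma recolor_lt s i k : i <= s -> k <= s -> k != i -> recolor s i k < s.
Proof. by rewrite /recolor; case: (k =P s); lia. Qed.

Section DisconnectedTypes.
Variable s : nat.
Hypothesis s2 : 2 <= s.

Definition two_cliques := copies 2 (K_ s.+1).

Lemma two_cliques_polar : spolar s.+1 [set: two_cliques].
Proof.
apply/spolarP; exists (fun u => if u.1 == ord0 then val u.2 else s.+1).
  move=> [i k] [j l] _ _ /=; rewrite /copies_adj /=.
  by case: eqP => [->|_]; case: eqP => [->|_]; rewrite ?ltnn.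
move=> [i k] [j l] _ _ /=; rewrite /copies_adj /= xpair_eqE.
case: (i =P ord0) => [_|/eqP i0]; first by rewrite leqNgt ltn_ord.
move=> _; case: (j =P ord0) => [_|/eqP j0]; first by rewrite leqNgt ltn_ord.
by rewrite (ord2_eq i0 j0) eqxx.
Qed.

(** The clique side meets at most one of the two cliques; the other one lies in the multipartite
    side and needs [s + 1] parts. After a deletion, the damaged clique gives [s] singleton parts. *)
Lemma two_cliques_min : min_spolar_obs s [set: two_cliques].
Proof.
apply/andP; split.
  apply/spolarP => -[f fA fB].
  have [j fj] : exists j : 'I_2, forall k, f (j, k) < s.
    case: (boolP [forall k, f (ord0, k) < s]) => [/forallP|].
      by exists ord0.
    case/forallPn => k; rewrite -leqNgt => fk; exists ord_max => l.
    rewrite ltnNge; apply/negP => fl.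
    by have := fB _ _ (in_setT _) (in_setT _) fk fl isT.
  apply: (@pigeonhole s (fun k => f (j, k))) => // k l E.
  have := fA (j, k) (j, l) (in_setT _) (in_setT _) (fj _) (fj _).
  by rewrite /= /copies_adj /= eqxx /= E eqxx => /negbFE/eqP.
apply/forall_inP => -[j i] _; apply/spolarP.
exists (fun u : two_cliques => if u.1 == j then recolor s (val i) (val u.2) else s).
  move=> [a k] [b l]; rewrite !inE !andbT /= /copies_adj /= /K_adj.
  rewrite !xpair_eqE; case: eqP => [->|]; rewrite ?ltnn // => ki.
  by case: eqP => [->|]; rewrite ?ltnn // => li _ _; rewrite recolor_neq ?eqxx.
move=> [a k] [b l]; rewrite !inE !andbT /= /copies_adj /= /K_adj !xpair_eqE.
case: eqP => [_ ki|/eqP aj _].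
  by rewrite leqNgt recolor_lt // -ltnS ltn_ord.
move=> + _; case: eqP => [_ li|/eqP bj _].
  by rewrite leqNgt recolor_lt // -ltnS ltn_ord.
by rewrite (ord2_eq aj bj) eqxx.
Qed.

Definition edge_and_join := gsum (K_ 2) (gjoin (K_ s) (copies 2 (K_ 1))).

(** The canonical parts: singletons numbered below [s], and the pair [2K_1] as part [s]. *)
Definition part2 (u : gjoin (K_ s) (copies 2 (K_ 1))) : nat :=
  if u is inl i then val i else s.

Lemma part2P u v : adj u v = (part2 u != part2 v).
Proof.
case: u v => [i|u] [j|v]; rewrite gjoinE ?copies_K1 //= ?eqxx //.
  by apply/esym; rewrite neq_ltn ltn_ord.
by apply/esym; rewrite neq_ltn ltn_ord orbT.
Qed.

Lemma edge_and_join_polar : spolar s.+1 [set: edge_and_join].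
Proof.
apply/spolarP; exists (fun u => if u is inr v then part2 v else s.+1).
  move=> [i|u] [j|v] _ _; rewrite ?ltnn // => _ _; exact: part2P.
have lt u : part2 u < s.+1 by case: u => [i|u] //=; rewrite ltnS ltnW.
move=> [i|u] [j|v] _ _ // ; first by move=> _; rewrite leqNgt lt.
  by rewrite leqNgt lt.
by rewrite leqNgt lt.
Qed.

(** If both ends of the edge are on the multipartite side, a vertex of the join on that side would
    share a part with each end; so the whole join is in the clique, which [2K_1] prevents. If an end
    is in the clique, the join is on the multipartite side and needs [s + 1] parts. *)
Lemma edge_and_join_min : min_spolar_obs s [set: edge_and_join].
Proof.
apply/andP; split.
  apply/spolarP => -[f fA fB].
  case: (boolP [forall j : 'I_2, f (inl j) < s]) => [/forallP fs|].
    have fH u : s <= f (inr u).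
      rewrite leqNgt; apply/negP => fu.
      have e (j : 'I_2) : f (inl j) = f (inr u).
        have := fA (inl j) (inr u) (in_setT _) (in_setT _) (fs j) fu.
        by move=> /esym/negbFE/eqP.
      have := fA (inl ord0) (inl ord_max) (in_setT _) (in_setT _) (fs _) (fs _).
      by rewrite !e eqxx.
    pose t (i : 'I_2) : edge_and_join := inr (inr (i, ord0)).
    have := fB (t ord0) (t ord_max) (in_setT _) (in_setT _) (fH _) (fH _) isT.
    by rewrite /t gsumE gjoin_rr copies_K1.
  case/forallPn => j; rewrite -leqNgt => fj.
  have fH u : f (inr u) < s.
    rewrite ltnNge; apply/negP => fu.
    by have := fB (inl j) (inr u) (in_setT _) (in_setT _) fj fu isT.
  pose k (i : 'I_s.+1) : gjoin (K_ s) (copies 2 (K_ 1)) :=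
    if insub (val i) is Some i' then inl i' else inr (ord0, ord0).
  have pk i : part2 (k i) = i.
    rewrite /k; case: insubP => [i' _ //|/=]; have := ltn_ord i.
    by rewrite -leqNgt /=; lia.
  apply: (@pigeonhole s (fun i => f (inr (k i)))) => // i i' E.
  have := fA (inr (k i)) (inr (k i')) (in_setT _) (in_setT _) (fH _) (fH _).
  by rewrite gsumE part2P !pk E eqxx => /negbFE/eqP/val_inj.
apply/forall_inP => -[j|[i|t]] _; apply/spolarP.
(* Without one end of the edge: the other end and [2K_1] form one part, and the rest is the
   clique. *)
- exists (fun u => if u is inr (inl _) then s else 0).
    move=> [a|[a|a]] [b|[b|b]]; rewrite ?ltnn //; last first.
      by rewrite gsumE gjoin_rr copies_K1.
    rewrite !inE !andbT !(inj_eq inl_inj) /= /K_adj -!(inj_eq val_inj) /=.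
    by have := ltn_ord a; have := ltn_ord b; have := ltn_ord j; lia.
  move=> [a|[a|a]] [b|[b|b]] _ _; rewrite ?[s <= 0]leqNgt ?(ltnW s2) //.
  by rewrite gsumE gjoin_ll.
(* Without vertex [i] of [K_s]: the edge is the clique, and [2K_1] takes the free colour [i]. *)
- exists (fun u => match u with inl _ => s | inr (inl k) => val k | _ => val i end).
    move=> [a|a] [b|b]; rewrite ?ltnn // !inE !andbT => ai bi _ _.
    rewrite gsumE part2P; move: ai bi.
    have := ltn_ord i; case: a b => [a|a] [b|b] //=;
      rewrite ?eqxx // !(inj_eq inr_inj) !(inj_eq inl_inj) -!(inj_eq val_inj) /=.
    - by have := ltn_ord a; lia.
    by have := ltn_ord b; lia.
  by move=> [a|[a|a]] [b|[b|b]] _ _ //=; have := ltn_ord i;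
    try have := ltn_ord a; try have := ltn_ord b; lia.
(* Without a vertex of [2K_1]: the rest of the join is the clique, and the ends of the edge are two
   singleton parts, which uses [s >= 2]. *)
exists (fun u => if u is inl k then val k else s).
  by move=> [a|a] [b|b]; rewrite ?ltnn.
move=> [a|a] [b|b]; rewrite ?[s <= val _]leqNgt ?(leq_trans (ltn_ord _) s2) //.
rewrite !inE !andbT => ai bi _ _; rewrite (inj_eq inr_inj) gsumE.
move: a b ai bi => [a|[a a']] [b|[b b']]; rewrite gjoinE //.
rewrite !(inj_eq inr_inj); case: t => t t'; rewrite !xpair_eqE !ord1 !eqxx !andbT.
by move=> aj bj; rewrite (ord2_eq aj bj) eqxx.
Qed.

Definition point_and_join := gsum (K_ 1) (gjoin (K_ (s - 1)) (C_ 4)).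

(** Singletons numbered below [s - 1], followed by the two parity classes of [C_4] as parts [s - 1]
    and [s]. *)
Definition part3 (u : gjoin (K_ (s - 1)) (C_ 4)) : nat :=
  match u with inl i => val i | inr c => s - 1 + odd c end.

Lemma part3P u v : adj u v = (part3 u != part3 v).
Proof.
case: u v => [i|u] [j|v]; rewrite gjoinE ?C4_odd //=.
- by have := ltn_ord i; lia.
- by have := ltn_ord j; lia.
by rewrite eqn_add2l; case: (odd u); case: (odd v).
Qed.

Lemma point_and_join_polar : spolar s.+1 [set: point_and_join].
Proof.
apply/spolarP; exists (fun u => if u is inr v then part3 v else s.+1).
  move=> [i|u] [j|v] _ _; rewrite ?ltnn // => _ _; exact: part3P.
have lt u : part3 u < s.+1.
  by case: u => [i|c] /=; [have := ltn_ord i|case: (odd c)]; lia.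
move=> [i|u] [j|v] _ _; rewrite ?[s < part3 _]leqNgt ?lt //.
Qed.

(** If the isolated vertex is on the multipartite side, all join vertices there share its part; but
    each diagonal of [C_4] has an end there, and ends of different diagonals are adjacent. If it is
    in the clique, the whole join needs [s + 1] parts. *)
Lemma point_and_join_min : min_spolar_obs s [set: point_and_join].
Proof.
have K1 (a b : K_ 1) : adj a b = false by rewrite /= /K_adj !ord1.
apply/andP; split.
  apply/spolarP => -[f fA fB]; pose z : point_and_join := inl ord0.
  pose c i : point_and_join := inr (inr i).
  have cE i j : adj (c i) (c j) = (odd i != odd j).
    by rewrite gsumE gjoin_rr C4_odd.
  have [fz|fz] := ltnP (f z) s.
    have fH u : f (inr u) < s -> f (inr u) = f z.
      move=> fu; have := fA z (inr u) (in_setT _) (in_setT _) fz fu.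
      by move/esym/negbFE/eqP.
    have one (i j : 'I_4) : i != j -> odd i = odd j -> exists k : 'I_4,
        f (c k) = f z /\ odd k = odd i.
      move=> ij oij; case: (ltnP (f (c i)) s) => [/fH|fi]; first by exists i.
      case: (ltnP (f (c j)) s) => [/fH|fj]; first by exists j.
      have cij : c i != c j by apply: contraNneq ij => -[->].
      by have := fB (c i) (c j) (in_setT _) (in_setT _) fi fj cij; rewrite cE oij eqxx.
    have [k [fk ok]] := one 0%:o 4 2%:o 4 isT erefl.
    have [l [fl ol]] := one 1%:o 4 3%:o 4 isT erefl.
    have := fA (c k) (c l) (in_setT _) (in_setT _).
    by rewrite fk fl fz eqxx cE ok ol => /(_ isT isT).
  have fH u : f (inr u) < s.
    rewrite ltnNge; apply/negP => fu.
    by have := fB z (inr u) (in_setT _) (in_setT _) fz fu isT.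
  pose k (i : 'I_s.+1) : gjoin (K_ (s - 1)) (C_ 4) :=
    if insub (val i) is Some i' then inl i' else
    if i == s :> nat then inr 1%:o 4 else inr 0%:o 4.
  have pk i : part3 (k i) = i.
    rewrite /k; case: insubP => [i' _ //|/=]; have := ltn_ord i.
    by rewrite -leqNgt /=; case: eqP => /=; lia.
  apply: (@pigeonhole s (fun i => f (inr (k i)))) => // i i' E.
  have := fA (inr (k i)) (inr (k i')) (in_setT _) (in_setT _) (fH _) (fH _).
  by rewrite gsumE part3P !pk E eqxx => /negbFE/eqP/val_inj.
apply/forall_inP => -[j|[i|t]] _; apply/spolarP.
(* Without the isolated vertex: the two classes of [C_4] are the parts. *)
- exists (fun u : point_and_join => if u is inr (inr c) then nat_of_bool (odd c) else s).
    move=> [a|[a|a]] [b|[b|b]] _ _; rewrite ?ltnn ?gsumE //  gjoin_rr C4_odd.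
    by case: (odd a); case: (odd b).
  have lt (b : bool) : s <= b = false by apply/negP; lia.
  move=> [a|[a|a]] [b|[b|b]]; rewrite ?lt // !inE ?ord1 //.
  by rewrite gsumE gjoin_ll.
- have ni v : inr v != inr (inl i) :> point_and_join -> part3 v != i.
    case: v => [k|k] /=; last by have := ltn_ord i; lia.
    by rewrite (inj_eq inr_inj) (inj_eq inl_inj).
  (* Without vertex [i] of the complete graph: the isolated vertex is the clique, and one class of
     [C_4] takes the colour [i]. *)
  exists (fun u : point_and_join => if u is inr v then recolor s (val i) (part3 v) else s).
    move=> [a|a] [b|b]; rewrite ?ltnn // !inE !andbT => /ni ai /ni bi _ _.
    by rewrite gsumE part3P recolor_neq.
  have lt v : inr v != inr (inl i) :> point_and_join ->
      s <= recolor s (val i) (part3 v) = false.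
    move=> /ni vi; apply/negbTE; rewrite -ltnNge recolor_lt //.
      by have := ltn_ord i => /=; lia.
    by case: (v) => [k|k] /=; [have := ltn_ord k; lia|case: (odd k); lia].
  move=> [a|a] [b|b]; rewrite !inE !andbT => ai bi; rewrite ?lt //.
(* Without a vertex [t] of [C_4]: the vertex opposite to [t] joins the clique, and the other
   diagonal forms one part with the isolated vertex. *)
exists (fun u : point_and_join => match u with inl _ => 0 | inr (inl _) => s
                 | inr (inr d) => if odd d == odd t then s else 0 end).
  move=> [a|[a|a]] [b|[b|b]] _ _; rewrite ?ltnn ?gsumE ?gjoin_rr ?K1 ?C4_odd //.
  - by case: ifP; rewrite ?ltnn.
  - by case: ifP; rewrite ?ltnn.
  by case: (odd a); case: (odd b); case: (odd t); rewrite ?eqxx ?ltnn.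
have s0 : (s <= 0) = false by apply/negbTE; rewrite -ltnNge ltnW.
move=> [a|[a|a]] [b|[b|b]]; rewrite ?s0 ?gsumE ?gjoinE //; try by case: ifP; rewrite ?s0.
case: eqP => // oa; last by rewrite s0.
case: eqP => // ob; last by rewrite s0.
rewrite !inE !andbT !(inj_eq inr_inj); move: t a b oa ob.
by case=> [[|[|[|[|?]]]] ?] [[|[|[|[|?]]]] ?] [[|[|[|[|?]]]] ?].
Qed.

(** Polarity with [s + 1] parts is what separates these graphs from the seven, and what the equation
    in (3) relies on. *)
Lemma disconnected_type_props (G : sgraph) : disconnected_type s G ->
  [/\ disc G, min_spolar_obs s [set: G] & spolar s.+1 [set: G]].
Proof.
have s1 : 0 < s - 1 by lia.
case=> [|[|]] GF; split.
- by apply: giso_disc GF _; apply: disc_copies (ord0 : K_ s.+1).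
- exact: giso_min_spolar_obs GF two_cliques_min.
- case: GF => f fb fa; rewrite -(spolar_emb (bij_inj fb) fa).
  exact: spolar_sub (subsetT _) two_cliques_polar.
- by apply: giso_disc GF _; apply: disc_gsum; [exact: ord0|right; exact: (ord0, ord0)].
- exact: giso_min_spolar_obs GF edge_and_join_min.
- case: GF => f fb fa; rewrite -(spolar_emb (bij_inj fb) fa).
  exact: spolar_sub (subsetT _) edge_and_join_polar.
- by apply: giso_disc GF _; apply: disc_gsum; [exact: ord0|right; exact: ord0].
- exact: giso_min_spolar_obs GF point_and_join_min.
- case: GF => f fb fa; rewrite -(spolar_emb (bij_inj fb) fa).
  exact: spolar_sub (subsetT _) point_and_join_polar.
Qed.
End DisconnectedTypes.

(** * Split graphs *)

Ltac adjs := repeat match goal with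
  | H : is_true (@adj ?F ?x ?y) |- context [@adj ?F ?x ?y] => rewrite H
  | H : is_true (@adj ?F ?x ?y) |- context [@adj ?F ?y ?x] =>
      rewrite [@adj F y x]adj_sym H
  | H : is_true (~~ @adj ?F ?x ?y) |- context [@adj ?F ?x ?y] => rewrite (negbTE H)
  | H : is_true (~~ @adj ?F ?x ?y) |- context [@adj ?F ?y ?x] =>
      rewrite [@adj F y x]adj_sym (negbTE H)
  end.

Ltac adj_absurd := match goal with
  | H : is_true (adj ?x ?x) |- _ => by rewrite adj_irrefl in H
  | H1 : is_true (adj ?x ?y), H2 : is_true (~~ adj ?x ?y) |- _ =>
      by rewrite H1 in H2
  | H1 : is_true (adj ?x ?y), H2 : is_true (~~ adj ?y ?x) |- _ =>
      by rewrite adj_sym H1 in H2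
  | H : is_true (?x != ?x) |- _ => by rewrite eqxx in H
  | H1 : is_true (?x \in ?A), H2 : is_true (?x \notin ?A) |- _ =>
      by rewrite H1 in H2
  end.

(* Two vertices differ as soon as they are adjacent or some recorded
   adjacency separates them. *)
Ltac neqs := let E := fresh in apply/eqP => E; subst; adj_absurd.

Ltac split_bools :=
  repeat match goal with |- is_true (_ && _) => apply/andP; split end;
  try by []; try neqs.

Ltac all_neqs := rewrite /= ?inE ?negb_or -?andbA /=; split_bools.

Ltac pattern_adj := adjs; rewrite /=; split_bools.

Section Forbidden.
Variable G : sgraph.
Implicit Types (a b c d e u v w x y z : G) (K L : {set G}).

Definition is_2K2 a b c d :=
  [&& adj a b, adj c d, ~~ adj a c, ~~ adj a d, ~~ adj b c & ~~ adj b d].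

Definition is_C4 a b c d :=
  [&& adj a b, adj b c, adj c d, adj d a, ~~ adj a c, ~~ adj b d, a != c & b != d].

Definition is_C5 a b c d e :=
  [&& adj a b, adj b c, adj c d, adj d e & adj e a] &&
  [&& ~~ adj a c, ~~ adj a d, ~~ adj b d, ~~ adj b e & ~~ adj c e].

Lemma stable_compl_split K : clique K -> {in ~: K &, forall x y, ~~ adj x y} ->
  spolar 1 [set: G].
Proof.
move=> /cliqueP cK sK; apply/spolarP; exists (fun x => nat_of_bool (x \in K)).
  move=> x y _ _; case: (boolP (x \in K)); case: (boolP (y \in K)) => //= yK xK _ _.
  by apply/negbTE/sK; rewrite inE.
move=> x y _ _; case: (boolP (x \in K)); case: (boolP (y \in K)) => //= yK xK _ _.
exact: cK.
Qed.

(* Among the cliques of largest size, one of largest degree sum is taken; the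
   common weight [#|G|] makes size take precedence. *)
Lemma foldes_hammer : ~~ spolar 1 [set: G] ->
  [\/ exists a b c d, is_2K2 a b c d, exists a b c d, is_C4 a b c d |
      exists a b c d e, is_C5 a b c d e].
Proof.
move=> ns; pose w x := #|[set y | adj x y]| + #|G|.
have c0 : clique (set0 : {set G}) by apply/cliqueP => x y; rewrite inE.
pose K : {set G} := [arg max_(K > set0 | clique K) \sum_(x in K) w x].
have [cK maxK] : clique K /\
    forall L : {set G}, clique L -> \sum_(x in L) w x <= \sum_(x in K) w x.
  by rewrite /K; case: arg_maxnP.
have /cliqueP aK := cK.
have [/forall_inP st|] := boolP [forall x in ~: K, forall y in ~: K, ~~ adj x y].
  case/negP: ns; apply: (stable_compl_split cK) => x y xK yK.
  by have /forall_inP := st x xK; apply.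
case/forall_inPn => x xK /forall_inPn[y yK /negbNE xy].
move: xK yK; rewrite !inE => xK yK.
have dw z : #|[set y | adj z y]| < #|G|.
  have <- : #|[set y | adj z y]| + #|~: [set y | adj z y]| = #|G| := cardsC _.
  rewrite -addn1 leq_add2l card_gt0.
  by apply/set0Pn; exists z; rewrite !inE adj_irrefl.
have grow (L : {set G}) u : clique L -> u \notin L -> {in L, forall z, adj u z} ->
    clique (u |: L).
  move=> /cliqueP cL uL uu; apply/cliqueP => p q; rewrite !inE.
  move=> /orP[/eqP->|pL] /orP[/eqP->|qL]; rewrite ?eqxx // => pq.
  - exact: uu.
  - by rewrite adj_sym uu.
  exact: cL.
have nn u : u \notin K -> exists2 a, a \in K & ~~ adj u a.
  move=> uK; have [/forall_inP h|/forall_inPn//] := boolP [forall z in K, adj u z].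
  have := maxK _ (grow _ _ cK uK h); rewrite big_setU1 //= /w.
  by have := dw u; set S := \sum_(_ in _) _; lia.
have [a aKa xa] := nn x xK; have [b0 b0K yb0] := nn y yK.
have KaK : {subset K :\ a <= K} by move=> z /setD1P[].
have cKa : clique (K :\ a) by apply/cliqueP => p q /KaK pK /KaK qK; apply: aK.
have sumK : \sum_(z in K) w z = w a + \sum_(z in K :\ a) w z by apply: big_setD1.
(* The edge [xy] may be assumed to have a common non-neighbour [a] in [K]: if each of [x], [y] sees
   the vertex missed by the other, these four vertices form a [C_4]. *)
wlog ya : x y xK yK xy a b0 aKa xa b0K yb0 KaK cKa sumK / ~~ adj y a.
  move=> H; have [ya|ya] := boolP (adj y a); last first.
    exact: (H x y xK yK xy a b0 aKa xa b0K yb0 KaK cKa sumK ya).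
  have [xb|xb] := boolP (adj x b0).
    constructor 2; exists x, y, a, b0; rewrite /is_C4.
    have ab : adj a b0 by apply: aK => //; neqs.
    by pattern_adj.
  have KbK : {subset K :\ b0 <= K} by move=> z /setD1P[].
  apply: (H x y xK yK xy b0 b0) => //.
    by apply/cliqueP => p q /KbK pK /KbK qK; apply: aK.
  exact: big_setD1.
(* A second common non-neighbour [b] gives the [2K_2] with edges [xy] and [ab]. *)
have [/existsP[b /and4P[bK ba xb yb]]|only] :=
    boolP [exists b, [&& b \in K, b != a, ~~ adj x b & ~~ adj y b]].
  constructor 1; exists x, y, a, b; rewrite /is_2K2.
  have ab : adj a b by apply: aK => //; rewrite eq_sym.
  by pattern_adj.
have adj1 z : z \in K :\ a -> adj x z || adj y z.
  move=> /setD1P[za zK]; apply: contraNT only; rewrite negb_or => /andP[xz yz].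
  by apply/existsP; exists z; rewrite zK za xz yz.
(* Otherwise [a] could be exchanged for both [x] and [y], and the larger clique has more weight
   since [w a < 2 * #|G|]. *)
have [b bKa nb] : exists2 b, b \in K :\ a & ~~ adj x b || ~~ adj y b.
  have [/forall_inP hx|/forall_inPn[b bK xb]] := boolP [forall z in K :\ a, adj x z];
    last by exists b; rewrite // xb.
  have [/forall_inP hy|/forall_inPn[b bK yb]] := boolP [forall z in K :\ a, adj y z];
    last by exists b; rewrite // yb orbT.
  have yKa : y \notin K :\ a by rewrite inE negb_and yK orbT.
  have xKa : x \notin y |: K :\ a.
    by rewrite !inE negb_or negb_and xK orbT andbT; neqs.
  have hx' : {in y |: K :\ a, forall z, adj x z}.
    by move=> z /setU1P[->//|]; apply: hx.
  have := maxK _ (grow _ _ (grow _ _ cKa yKa hy) xKa hx').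
  rewrite big_setU1 //= big_setU1 //= sumK addnA leq_add2r leqNgt.
  case/negP; apply: (@leq_trans (#|G| + #|G|)); first by rewrite ltn_add2r dw.
  by apply: leq_add; apply: leq_addl.
move: nb adj1 {only b0 b0K yb0}; wlog yb : x y xK yK xy xa ya / ~~ adj y b.
  move=> H nb adj1; case/orP: (nb) => nb'; last exact: (H x y).
  apply: (H y x) => //; [by rewrite adj_sym|by rewrite orbC|].
  by move=> z zK; rewrite orbC; apply: adj1.
move=> _ adj1.
have xb : adj x b by have := adj1 b bKa; rewrite (negbTE yb) orbF.
have [[ba bK] ab] : (b != a /\ b \in K) /\ adj a b.
  by case/setD1P: (bKa) => ba bK; split=> //; apply: aK; rewrite // eq_sym.
have [/forall_inP hx|/forall_inPn[c cK' xc]] :=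
    boolP [forall z in K :\ a, adj x z]; last first.
  have c_K := KaK _ cK'; constructor 2; exists x, y, c, b.
  have yc : adj y c by have := adj1 c cK'; rewrite (negbTE xc).
  have cb : adj c b by apply: aK => //; neqs.
  by rewrite /is_C4; pattern_adj.
have xKa : x \notin K :\ a by rewrite inE negb_and xK orbT.
(* Exchanging [a] for [x] keeps the size, so the degree sum decides: [x] has no more neighbours than
   [a]. As [y] is seen by [x] only, some [v] is seen by [a] only. *)
have := maxK _ (grow _ _ cKa xKa hx); rewrite big_setU1 //= sumK leq_add2r.
rewrite /w leq_add2r => deg.
have [v av xv] : exists2 v, adj a v & ~~ adj x v.
  have : ~~ ([set z | adj a z] \proper [set z | adj x z]).
    by apply: contraTN deg => /proper_card; rewrite -ltnNge.
  rewrite properE negb_and negbK => /orP[/subsetPn[v]|/subsetP/(_ y)].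
    by rewrite !inE => av xv; exists v.
  by rewrite !inE xy adj_sym (negbTE ya) => /(_ isT).
have vK : v \notin K.
  apply/negP => vK; have va : v != a by neqs.
  by have := hx v; rewrite !inE va vK (negbTE xv) => /(_ isT).
have [vy|vy] := boolP (adj v y); last first.
  by constructor 1; exists a, v, x, y; rewrite /is_2K2; pattern_adj.
have [vb|vb] := boolP (adj v b).
  by constructor 2; exists v, b, x, y; rewrite /is_C4; pattern_adj.
by constructor 3; exists v, a, b, x, y; rewrite /is_C5; pattern_adj.
Qed.
End Forbidden.

(** * Disconnected obstructions *)

Section Representatives.
Variables (G : sgraph) (A : {set G}).
Hypothesis mA : multipartite A.

Lemma representatives (B : {set G}) k : B \subset A -> k <= #|nonnbrs A @: B| ->
  exists r : 'I_k -> G, (forall i, r i \in B) /\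
    (forall i j, adj (r i) (r j) = (i != j)).
Proof.
move=> /subsetP BA kB.
have /fin_all_exists[r rP] : forall i : 'I_k, exists x,
    x \in B /\ nonnbrs A x = nth set0 (enum (nonnbrs A @: B)) i.
  move=> i; have : nth set0 (enum (nonnbrs A @: B)) i \in nonnbrs A @: B.
    by rewrite -mem_enum mem_nth // -cardE (leq_trans (ltn_ord i)).
  by case/imsetP => x xB E; exists x.
exists r; split=> [i|i j]; first by case: (rP i).
have [[iB Ei] [jB Ej]] := (rP i, rP j).
rewrite -[LHS]negbK -(nonnbrs_eq mA) ?BA // Ei Ej nth_uniq ?enum_uniq //;
  by rewrite -cardE (leq_trans (ltn_ord _)).
Qed.

Lemma card_nonnbrs_setD (B : {set G}) x : B \subset A -> x \in A ->
  #|nonnbrs A @: B| <= #|nonnbrs A @: (B :\: nonnbrs A x)|.+1.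
Proof.
move=> /subsetP BA xA.
apply: (@leq_trans #|nonnbrs A x |: nonnbrs A @: (B :\: nonnbrs A x)|).
  apply: subset_leq_card; apply/subsetP => _ /imsetP[y yB ->].
  rewrite in_setU1 eq_sym nonnbrs_eq ?(BA y yB) //.
  case: (boolP (adj x y)) => //= xy.
  by rewrite imset_f // !inE xy andbF.
by apply: leq_trans (leq_card_setU _ _) _; rewrite cards1.
Qed.
End Representatives.

Section Disconnected.
Variables (G : sgraph) (s : nat).
Hypotheses (s2 : 2 <= s) (mG : min_spolar_obs s [set: G]).
Implicit Types (x y z : G) (P : {set G}).

Let nG : ~ spolar s [set: G].
Proof. by case/min_spolar_obsP: mG. Qed.

Definition separated P := forall x y, x \in P -> y \notin P -> ~~ adj x y.

Lemma separatedC P : separated P -> separated (~: P).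
Proof. by move=> h x y; rewrite !inE negbK adj_sym => xP yP; apply: h. Qed.

Lemma not_multipartiteP P : ~~ multipartite P -> exists x y z,
  [/\ x \in P, y \in P, z \in P & [&& adj x z, ~~ adj x y & ~~ adj y z]].
Proof.
case/forall_inPn => x xP /forall_inPn[y yP /forall_inPn[z zP]].
rewrite negb_imply negb_or => h; by exists x, y, z.
Qed.

(** A violation is an induced [K_1 + K_2]; with the edge on the other side it makes [K_1 + 2K_2]. *)
Lemma side_multipartite P p p' : separated P -> p \notin P -> p' \notin P ->
  adj p p' -> sporadic G \/ multipartite P.
Proof.
move=> sP pP p'P pp'; have [|/not_multipartiteP] := boolP (multipartite P).
  by right.
move=> [x [y [z [xP yP zP /and3P[xz xy yz]]]]]; left.
have [[xp yp] zp] := (sP _ _ xP pP, sP _ _ yP pP, sP _ _ zP pP).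
have [[xp' yp'] zp'] := (sP _ _ xP p'P, sP _ _ yP p'P, sP _ _ zP p'P).
apply: (sporadic_match (t := [:: y; x; z; p; p']) mG); first by all_neqs.
by rewrite /=; adjs.
Qed.

Lemma multipartite_P3 P p p' : multipartite P -> p \in P -> p' \in P ->
  adj p p' -> ~~ clique P -> exists x y z,
  [/\ x \in P, y \in P, z \in P & [&& x != y, ~~ adj x y, adj x z & adj y z]].
Proof.
move=> /multipartiteP mP pP p'P pp' /forall_inPn[x xP /forall_inPn[y yP]].
rewrite negb_imply => /andP[xy nxy].
have [z zP xz] : exists2 z, z \in P & adj x z.
  have /orP[] := mP _ _ _ pP xP p'P pp'; last by exists p'.
  by rewrite adj_sym; exists p.
exists x, y, z; split=> //; rewrite xy nxy xz /=.
by have := mP _ _ _ xP yP zP xz; rewrite (negbTE nxy).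
Qed.

(** With [P] as the clique, non-polarity gives [~: P] more than [s] parts. If these are all
    singletons, [P] has more than [s] vertices by symmetry and [2K_{s+1}] appears; otherwise a part
    with two vertices, [s] further parts and an edge of [P] give the second graph of (2). *)
Lemma clique_multipartite_case P p p' : separated P -> p \in P -> p' \in P ->
  adj p p' -> clique P -> multipartite (~: P) -> disconnected_type s G.
Proof.
move=> sP pP p'P pp' cP mQ.
have QP x y : x \notin P -> y \in P -> ~~ adj x y.
  by move=> xP yP; rewrite adj_sym; apply: sP.
have nQ : s < nparts (~: P).
  rewrite ltnNge; apply/negP => le; apply: nG; apply/existsP; exists (~: P).
  by rewrite subsetT mQ le setTD setCK.
have [cQ|ncQ] := boolP (clique (~: P)).
  have nP : s < #|P|.
    rewrite ltnNge; apply/negP => le; apply: nG; apply/existsP; exists P.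
    rewrite subsetT setTD cQ (leq_trans (leq_imset_card _ _) le) !andbT /=.
    apply/multipartiteP => x y z xP yP zP xz; case: (x =P y) => [<-|/eqP xy].
      by rewrite xz orbT.
    by move/cliqueP: cP => ->.
  left; apply: (emb_giso mG); first by case/min_spolar_obsP: (two_cliques_min s).
  have [r' [r'Q r'adj]] := representatives mQ (subxx _) nQ.
  pose r (i : 'I_s.+1) := enum_val (widen_ord nP i).
  have rP i : r i \in P by apply: enum_valP.
  have radj i j : adj (r i) (r j) = (i != j).
    case: eqP => [->|/eqP ij]; first by rewrite adj_irrefl.
    move/cliqueP: cP; apply; rewrite ?rP //.
    by apply: contraNneq ij => /enum_val_inj/(congr1 val)/= /val_inj ->.
  have rr' i j : adj (r i) (r' j) = false.
    by apply/negbTE/sP; rewrite ?rP // -in_setC.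
  have fadj : {mono (fun u : two_cliques s => if u.1 == ord0 then r u.2 else r' u.2)
       : u v / adj u v}.
    move=> [a i] [b j] /=; rewrite /copies_adj /=.
    case: (a =P ord0) => [->|/eqP a0]; case: (b =P ord0) => [->|/eqP b0] //=.
    - by rewrite rr' eq_sym (negbTE b0).
    - by rewrite adj_sym rr' (negbTE a0).
    by rewrite r'adj (ord2_eq a0 b0) eqxx.
  eexists; last exact: fadj.
  move=> [a i] [b j] /= E; apply/eqP; rewrite xpair_eqE; apply/negPn/negP => ne.
  move: ne E; case: (a =P ord0) => [->|/eqP a0]; case: (b =P ord0) => [->|/eqP b0] /=.
  - by move=> ij E; have := radj i j; rewrite E adj_irrefl ij.
  - by move=> _ E; have := r'Q j; rewrite -E inE rP.
  - by move=> _ E; have := r'Q i; rewrite E inE rP.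
  rewrite (ord2_eq a0 b0) eqxx /= => ij E.
  by have := r'adj i j; rewrite E adj_irrefl ij.
right; left; apply: (emb_giso mG).
  by case/min_spolar_obsP: (edge_and_join_min s2).
have [x [y [z [xQ yQ zQ]]]] : exists x y z, [/\ x \notin P, y \notin P, z \notin P &
    [&& x != y, ~~ adj x y, adj x z & adj y z]].
  have [u [v [uQ vQ uv]]] : exists u v, [/\ u \in ~: P, v \in ~: P & adj u v].
    have [|r [rQ radj]] := @representatives _ _ mQ (~: P) 2 (subxx _).
      exact: leq_trans (leqW s2) nQ.
    by exists (r ord0), (r ord_max); rewrite !rQ radj.
  have [x [y [z [xQ yQ zQ h]]]] := multipartite_P3 mQ uQ vQ uv ncQ.
  by exists x, y, z; move: xQ yQ zQ; rewrite !inE.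
case/and4P=> xy nxy _ _ {z zQ}.
have xQ' : x \in ~: P by rewrite inE.
(* Leaving out the part of [x] costs one of the more than [s] parts. *)
have [r [rB radj]] := @representatives _ _ mQ (~: P :\: nonnbrs (~: P) x) s
  (subsetDl _ _) (leq_trans nQ (card_nonnbrs_setD mQ (subxx _) xQ')).
have rQ i : r i \notin P by have /setDP[] := rB i; rewrite inE.
have rx i : adj x (r i).
  by have /setDP[_] := rB i; rewrite mem_nonnbrs inE rQ negbK.
have ry i : adj y (r i).
  have := multipartiteP _ mQ x y (r i); rewrite !inE xQ yQ rQ => /(_ isT isT isT (rx i)).
  by rewrite (negbTE nxy).
have yx : ~~ adj y x by rewrite adj_sym.
pose f (u : edge_and_join s) : G := match u with
  | inl j => if j == ord0 then p else p'
  | inr (inl i) => r i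
  | inr (inr t) => if t.1 == ord0 then x else y end.
have fP j : f (inl j) \in P by rewrite /f; case: ifP.
have fQ u : f (inr u) \notin P by case: u => [i|t] /=; rewrite ?rQ //; case: ifP.
have f1 i j : adj (f (inl i)) (f (inl j)) = (i != j).
  rewrite /f; case: (i =P ord0) => [->|/eqP i0]; case: (j =P ord0) => [->|/eqP j0];
    rewrite ?adj_irrefl ?eqxx ?i0 ?pp' ?[adj p' p]adj_sym ?pp' //.
  - by rewrite eq_sym j0.
  by rewrite (ord2_eq i0 j0) eqxx.
have fadj : {mono f : u v / adj u v}.
  move=> [i|[i|t]] [j|[j|t']]; rewrite gsumE ?gjoinE ?copies_K1.
  - exact: f1.
  - by apply/negbTE/sP.
  - by apply/negbTE/sP.
  - by apply/negbTE/QP.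
  - exact: radj.
  - by rewrite /f; case: ifP => _; rewrite adj_sym ?rx ?ry.
  - by apply/negbTE/QP.
  - by rewrite /f; case: ifP => _; rewrite ?rx ?ry.
  by rewrite /f; case: ifP; case: ifP; rewrite ?adj_irrefl ?(negbTE nxy) ?(negbTE yx).
exists f => // u v E.
have : adj (f u) (f v) = false by rewrite E adj_irrefl.
rewrite fadj; move: u v E => [i|[i|t]] [j|[j|t']] E; rewrite gsumE ?gjoinE ?copies_K1 //.
- by move=> /negbFE/eqP->.
- by move=> _; have := fQ (inl j); rewrite -E fP.
- by move=> _; have := fQ (inr t'); rewrite -E fP.
- by move=> _; have := fQ (inl i); rewrite E fP.
- by move=> /negbFE/eqP->.
- by move=> _; have := fQ (inr t); rewrite E fP.
move: t t' E => [t w] [t' w'] E _; rewrite !ord1; congr (inr (inr (_, _))).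
move: E => /=; case: (t =P ord0) => [->|/eqP t0]; case: (t' =P ord0) => [->|/eqP t0'] //.
- by move=> E; rewrite E eqxx in xy.
- by move=> E; rewrite E eqxx in xy.
by rewrite (ord2_eq t0 t0').
Qed.

(** The graph is not split. A [2K_2] or [C_5] forms a sporadic graph with [z]. Given a [C_4], either
    some vertex attaches to a [C_4] in a way that yields a sporadic graph, or all of [G - z] is
    complete multipartite and contains the third graph of (2). *)
Lemma isolated_case z : (forall x, ~~ adj z x) -> sporadic G \/ disconnected_type s G.
Proof.
move=> zi; have ns : ~~ spolar 1 [set: G].
  by apply/negP => /(spolar_leq (ltnW s2)).
(* The allowed traces on a [C_4] are one diagonal or everything. Seeing 0, 1, 2 consecutive or 3
   vertices gives, with [z], respectively [2K_1 + C_4], [K_1 + P], [K_1] plus the complement of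
   [P_5], and [K_1] plus the complement of [P_3 + K_2]. *)
pose good := [forall a, forall b, forall c, forall d, forall v,
  is_C4 a b c d && (v != z) ==>
  [&& adj v a == adj v c, adj v b == adj v d & adj v a || adj v b]].
have [|/forallPn[a /forallPn[b /forallPn[c /forallPn[d /forallPn[v]]]]]] :=
    boolP good; last first.
  rewrite negb_imply => /andP[/andP[/and5P[ab bc cd da /and4P[ac bd a_c b_d]] vz] nv].
  have [[za zb] zc] := (zi a, zi b, zi c); have [zd zv] := (zi d, zi v); left.
  pose m := sporadic_match (k := s) (G := G).
  have [va|va] := boolP (adj v a); have [vb|vb] := boolP (adj v b);
  have [vc|vc] := boolP (adj v c); have [vd|vd] := boolP (adj v d);
    move: nv; rewrite ?va ?vb ?vc ?vd ?(negbTE va) ?(negbTE vb) ?(negbTE vc)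
      ?(negbTE vd) //= => _;
  first [ refine (m [:: z; a; b; c; d; v] mG _ _); [all_neqs|by rewrite /=; adjs]
        | refine (m [:: z; d; a; b; c; v] mG _ _); [all_neqs|by rewrite /=; adjs]
        | refine (m [:: z; c; d; a; b; v] mG _ _); [all_neqs|by rewrite /=; adjs]
        | refine (m [:: z; b; c; d; a; v] mG _ _); [all_neqs|by rewrite /=; adjs]
        | refine (m [:: z; v; a; b; c; d] mG _ _); [all_neqs|by rewrite /=; adjs] ].
move=> gd.
have goodP a b c d v : is_C4 a b c d -> v != z ->
    [/\ adj v a = adj v c, adj v b = adj v d & adj v a || adj v b].
  move=> C vz; move: gd => /forallP/(_ a)/forallP/(_ b)/forallP/(_ c)/forallP/(_ d).
  by move/forallP/(_ v); rewrite C vz /= => /and3P[/eqP -> /eqP ->].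
have [] := foldes_hammer ns.
- move=> [a [b [c [d /and5P[ab cd ac ad /andP[bc bd]]]]]]; left.
  have [[za zb] [zc zd]] := ((zi a, zi b), (zi c, zi d)).
  refine (sporadic_match (t := [:: z; a; b; c; d]) mG _ _); first by all_neqs.
  by rewrite /=; adjs.
- move=> [a [b [c [d C]]]]; right; right; right.
  have /and5P[ab bc cd da /and4P[ac bd a_c b_d]] := C.
  have [[za zb] [zc zd]] := ((zi a, zi b), (zi c, zi d)).
  have nz u v : adj u v -> u != z.
    by apply: contraTneq => ->; apply: zi.
  have [az bz] : a != z /\ b != z by rewrite (nz _ _ ab) (nz _ _ bc).
  pose R := [set~ z].
  have mR : multipartite R.
    (* Here [u] can take the place of [d'] opposite [b'] in the cycle, so every vertex sees both or
       neither of [u] and [b']. *)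
    have twin a' b' c' d' u v : is_C4 a' b' c' d' -> u != z -> v != z ->
        adj u a' -> ~~ adj u b' -> adj v u = adj v b'.
      move=> C' uz vz ua ub; have [->//|/eqP u_b] := u =P b'.
      have /and5P[ab' bc' cd' da' /and4P[nac nbd a_c' b_d']] := C'.
      have [ac' _ _] := goodP _ _ _ _ u C' uz.
      have uc : adj u c' by rewrite -ac'.
      have C1 : is_C4 a' u c' b' by rewrite /is_C4; pattern_adj.
      by have [_ ->] := goodP _ _ _ _ v C1 vz.
    (* Since [y] is a twin of [b'], so is its non-neighbour [x]; hence [w] sees [x] only if it sees
       [y]. *)
    have side a' b' c' d' x y w : is_C4 a' b' c' d' -> x != z -> y != z -> w != z ->
        ~~ adj x y -> ~~ adj y w -> adj y a' -> ~~ adj y b' -> adj x w -> False.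
      move=> C' xz yz wz xy yw ya yb xw; have tw := twin _ _ _ _ _ _ C'.
      have xb : ~~ adj x b' by rewrite -(tw y x).
      have xa : adj x a'.
        by have [_ _] := goodP _ _ _ _ x C' xz; rewrite (negbTE xb) orbF.
      by move: xw; rewrite adj_sym (tw x w) // -(tw y w) // adj_sym (negbTE yw).
    apply/multipartiteP => x y w; rewrite !inE => xz yz wz xw.
    apply: contraT; rewrite negb_or => /andP[xy yw].
    have Cr : is_C4 b a d c.
      by rewrite /is_C4; pattern_adj; rewrite eq_sym.
    have [ac' bd' oy] := goodP _ _ _ _ y C yz.
    have [ya|ya] := boolP (adj y a); have [yb|yb] := boolP (adj y b).
    (* When [y] sees the whole cycle, so do its non-neighbours [x] and [w]; then [x] and [y] are
       opposite on a new [C_4], which [w] meets in a forbidden way. *)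
    - have yc : adj y c by rewrite -ac'.
      have yd : adj y d by rewrite -bd'.
      have all u : u != z -> ~~ adj u y -> [/\ adj u a, adj u b, adj u c & adj u d].
        move=> uz uy; have [acu bdu ou] := goodP _ _ _ _ u C uz.
        have [ua|ua] := boolP (adj u a); have [ub|ub] := boolP (adj u b).
        - by rewrite -acu -bdu.
        - by rewrite adj_sym (twin _ _ _ _ _ y C) ?yb in uy.
        - by rewrite adj_sym (twin _ _ _ _ _ y Cr) ?ya in uy.
        by move: ou; rewrite (negbTE ua) (negbTE ub).
      have [xa xb xc xd] := all x xz xy.
      have wy : ~~ adj w y by rewrite adj_sym.
      have [wa wb wc wd] := all w wz wy.
      have C1 : is_C4 a x c y by rewrite /is_C4; pattern_adj.
      by have [_ E _] := goodP _ _ _ _ w C1 wz; move: wy; rewrite -E adj_sym xw.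
    - by case: (side a b c d x y w).
    - by case: (side b a d c x y w).
    by move: oy; rewrite (negbTE ya) (negbTE yb).
  have cz : clique (~: R).
    by apply/cliqueP => u v; rewrite !inE !negbK => /eqP-> /eqP->; rewrite eqxx.
  have nR : s < nparts R.
    rewrite ltnNge; apply/negP => le; apply: nG; apply/existsP; exists R.
    by rewrite subsetT mR le setTD.
  have [aR bR] : a \in R /\ b \in R by rewrite !inE.
  have Ba : R :\: nonnbrs R a \subset R := subsetDl _ _.
  (* The parts of [a] and [b] are left to the cycle. *)
  have nB : s - 1 <= #|nonnbrs R @: (R :\: nonnbrs R a :\: nonnbrs R b)|.
    have h1 := leq_trans nR (card_nonnbrs_setD mR (subxx _) aR).
    rewrite ltnS in h1; have h2 := leq_trans h1 (card_nonnbrs_setD mR Ba bR).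
    by rewrite leq_subLR.
  have [r [rB radj]] := representatives mR (subset_trans (subsetDl _ _) Ba) nB.
  have rab i : [/\ r i != z, adj a (r i) & adj b (r i)].
    have := rB i; rewrite !inE => /andP[+ /andP[+ rz]].
    by rewrite rz /= !negbK.
  have rcd i : adj c (r i) /\ adj d (r i).
    have [rz ra rb] := rab i; have [ac' bd' _] := goodP _ _ _ _ (r i) C rz.
    by rewrite [adj c _]adj_sym -ac' [adj d _]adj_sym -bd' ![adj (r i) _]adj_sym.
  apply: (emb_giso mG); first by case/min_spolar_obsP: (point_and_join_min s2).
  pose q (i : 'I_4) := nth z [:: a; b; c; d] i.
  have qadj : {mono (q : C_ 4 -> G) : i j / adj i j}.
    move=> i j; rewrite [RHS]C4_odd /q.
    by case: i j => [[|[|[|[|?]]]] ?] [[|[|[|[|?]]]] ?] //=; rewrite ?adj_irrefl //; adjs.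
  have qr i j : adj (q j) (r i).
    have [[_ ra rb] [rc rd]] := (rab i, rcd i).
    by case: j => [[|[|[|[|?]]]] ?].
  pose f (u : point_and_join s) : G := match u with
    | inl _ => z | inr (inl i) => r i | inr (inr j) => q j end.
  have fadj : {mono f : u v / adj u v}.
    move=> [i|[i|i]] [j|[j|j]]; rewrite gsumE ?gjoinE /f ?qr ?radj ?qadj //.
    - by rewrite adj_irrefl /= /K_adj !ord1.
    - by apply/negbTE.
    - by apply/negbTE.
    - by rewrite adj_sym; apply/negbTE.
    - by rewrite adj_sym qr.
    by rewrite adj_sym; apply/negbTE.
  exists f => // u v E.
  have : adj (f u) (f v) = false by rewrite E adj_irrefl.
  have qz i : q i != z.
    by case: i => [[|[|[|[|?]]]] ?] //=; [apply: nz cd|apply: nz da].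
  have rz i : r i != z by case: (rab i).
  rewrite fadj; move: u v E => [i|[i|i]] [j|[j|j]]; rewrite /f gsumE ?gjoinE //.
  - by rewrite !ord1.
  - by move=> E; have := rz j; rewrite -E eqxx.
  - by move=> E; have := qz j; rewrite -E eqxx.
  - by move=> E; have := rz i; rewrite E eqxx.
  - by move=> _ /negbFE/eqP->.
  - by move=> E; have := qz i; rewrite E eqxx.
  move=> E _; congr (inr (inr _)); apply: val_inj; move: E; rewrite /q.
  by move/eqP; rewrite nth_uniq => [/eqP|||] //; all_neqs.
move=> [a [b [c [d [e /andP[/and5P[ab bc cd de ea] /and5P[ac ad bd be ce]]]]]]]; left.
have [[za zb] [zc [zd ze]]] := ((zi a, zi b), (zi c, (zi d, zi e))).
refine (sporadic_match (t := [:: z; a; b; c; d; e]) mG _ _); first by all_neqs.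
by rewrite /=; adjs.
Qed.

(** A side without edges consists of isolated vertices. Otherwise both sides are multipartite, or
    [K_1 + 2K_2] appears; if neither is a clique, each contains a [P_3], which makes [2P_3]. *)
Lemma disconnected_obstruction : disc G -> sporadic G \/ disconnected_type s G.
Proof.
case/discP => P [[x xP] [y yP] sP].
have [|] := boolP [exists u in P, exists v in P, adj u v]; last first.
  move/exists_inPn => st; apply: (@isolated_case x) => v.
  have [vP|vP] := boolP (v \in P); last exact: sP.
  by have /exists_inPn/(_ v vP) := st x xP.
case/exists_inP=> p pP /exists_inP[p' p'P pp'].
have [|] := boolP [exists u in ~: P, exists v in ~: P, adj u v]; last first.
  move/exists_inPn => st; apply: (@isolated_case y) => v.
  have [vP|vP] := boolP (v \in P); first by rewrite adj_sym; apply: sP.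
  have yQ : y \in ~: P by rewrite inE.
  by have /exists_inPn/(_ v) := st y yQ; rewrite inE => /(_ vP).
case/exists_inP=> q qQ /exists_inP[q' q'Q qq'].
have sQ := separatedC sP; have [[qP q'P] [pQ p'Q]] :
    (q \notin P /\ q' \notin P) /\ (p \notin ~: P /\ p' \notin ~: P).
  by move: qQ q'Q; rewrite !inE !negbK.
have [|mP] := side_multipartite sP qP q'P qq'; first by left.
have [|mQ] := side_multipartite sQ pQ p'Q pp'; first by left.
have [cP|ncP] := boolP (clique P).
  by right; apply: clique_multipartite_case sP pP p'P pp' cP mQ.
have [cQ|ncQ] := boolP (clique (~: P)).
  by right; apply: clique_multipartite_case sQ qQ q'Q qq' cQ _; rewrite setCK.
left.
have [a [b [c [aP bP cP /and4P[a_b ab ac bc]]]]] := multipartite_P3 mP pP p'P pp' ncP.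
have [d [e [f [dQ eQ fQ /and4P[d_e de df ef]]]]] := multipartite_P3 mQ qQ q'Q qq' ncQ.
move: dQ eQ fQ; rewrite !inE => dP eP fP.
have [[ad ae] af] := (sP _ _ aP dP, sP _ _ aP eP, sP _ _ aP fP).
have [[bd be] bf] := (sP _ _ bP dP, sP _ _ bP eP, sP _ _ bP fP).
have [[cd ce] cf] := (sP _ _ cP dP, sP _ _ cP eP, sP _ _ cP fP).
refine (sporadic_match (t := [:: a; c; b; d; f; e]) mG _ _); first by all_neqs.
by rewrite /=; adjs.
Qed.
End Disconnected.

(** * Modules in P4-sparse and P4-extendible graphs *)

Section P4Classes.
Variable G : sgraph.
Implicit Types (a b c d m p q r u v w x y z : G) (M P Q S : {set G}).

Definition path4 a b c d :=
  [&& adj a b, adj b c, adj c d, ~~ adj a c & ~~ adj b d] && ~~ adj a d.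

Lemma path4_is_P4 a b c d : path4 a b c d -> is_P4 [set x in [:: a; b; c; d]].
Proof.
move=> /andP[/and5P[ab bc cd ac bd] ad]; set W := [set x in _].
pose q (i : 'I_4) := nth a [:: a; b; c; d] i.
have qW i : q i \in W by rewrite inE mem_nth.
have ut : uniq [:: a; b; c; d] by all_neqs.
have qi : injective (fun i => exist _ (q i) (qW i) : induced W).
  by move=> i j /(congr1 val)/= /eqP; rewrite nth_uniq // => /eqP/val_inj.
have [|f gK fK] := inj_card_bij qi.
  rewrite [X in X <= _]card_sig [X in _ <= X]card_ord.
  have <- : #|W| = 4 by rewrite cardsE; apply/card_uniqP.
  by apply: subset_leq_card; apply/subsetP.
exists f; first by exists (fun i => exist _ (q i) (qW i)).
move=> x y; rewrite -[x]fK -[y]fK !gK /= /induced_adj /=.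
case: (f x) (f y) => [[|[|[|[|?]]]] ?] [[|[|[|[|?]]]] ?] //=; rewrite /q /= ?adj_irrefl //;
  by adjs.
Qed.

Definition touches (t : seq G) u := exists a b c d,
  [/\ path4 a b c d, u \in [:: a; b; c; d] & has (mem t) [:: a; b; c; d]].

Lemma extendible_touches a b c d u v : P4_extendible G -> path4 a b c d ->
  u \notin [:: a; b; c; d] -> v \notin [:: a; b; c; d] ->
  touches [:: a; b; c; d] u -> touches [:: a; b; c; d] v -> u = v.
Proof.
move=> ext /path4_is_P4 pW uW vW.
have tm w : touches [:: a; b; c; d] w ->
    in_P4_meeting [set x in [:: a; b; c; d]] w.
  move=> [a' [b' [c' [d' [/path4_is_P4 p' wW /hasP[y yW yW']]]]]].
  exists [set x in [:: a'; b'; c'; d']]; split=> //; first by rewrite inE.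
  by apply/set0Pn; exists y; rewrite in_setI [y \in _]inE yW inE.
by move=> /tm tu /tm tv; apply: (ext _ pW u v _ _ tu tv); rewrite inE.
Qed.

Lemma sparse_unique (s : seq G) a b c d a' b' c' d' x : P4_sparse G ->
  size s = 5 -> uniq s -> path4 a b c d -> path4 a' b' c' d' ->
  all (mem s) [:: a; b; c; d] -> all (mem s) [:: a'; b'; c'; d'] ->
  x \in [:: a; b; c; d] -> x \notin [:: a'; b'; c'; d'] -> False.
Proof.
move=> sp sz us /path4_is_P4 p1 /path4_is_P4 p2 /allP s1 /allP s2 x1 x2.
have : [set x in [:: a; b; c; d]] = [set x in [:: a'; b'; c'; d']].
  apply: (sp [set y in s]) => //.
  - by rewrite cardsE -sz; apply/card_uniqP.
  - by apply/subsetP => y; rewrite !in_set; apply: s1.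
  by apply/subsetP => y; rewrite !in_set; apply: s2.
by move/setP/(_ x); rewrite !in_set x1 (negbTE x2).
Qed.

Definition p4_class := P4_extendible G \/ P4_sparse G.

(** Two such vertices already give two [P_4]s on five vertices. Extendibility tolerates one vertex
    outside a path, hence three: [m2] and [m3] would both touch the path of [m1]. The same count
    proves [three_middles] and makes modules with three vertices the right size. *)
Lemma three_ends m1 m2 m3 x y z : p4_class ->
  uniq [:: m1; m2; m3] -> (forall m, m \in [:: m1; m2; m3] -> path4 m x y z) -> False.
Proof.
move=> cl; rewrite /= !inE !negb_or -!andbA => /and4P[m12 m13 m23 _] h.
have [p1 p2 p3] : [/\ path4 m1 x y z, path4 m2 x y z & path4 m3 x y z].
  by rewrite !h ?inE ?eqxx ?orbT.
have /andP[/and5P[m1x xy yz m1y xz] m1z] := p1.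
have /andP[/and5P[m2x _ _ m2y _] m2z] := p2.
have /andP[/and5P[m3x _ _ m3y _] m3z] := p3.
case: cl => cl.
  move/eqP: m23; apply; apply: (extendible_touches cl p1); try by all_neqs.
    by exists m2, x, y, z; rewrite p2 /= !inE !eqxx !orbT.
  by exists m3, x, y, z; rewrite p3 /= !inE !eqxx !orbT.
apply: (@sparse_unique [:: m1; m2; x; y; z] _ _ _ _ _ _ _ _ m1 cl _ _ p1 p2) => //.
- by all_neqs.
- by rewrite /= !inE !eqxx !orbT.
- by rewrite /= !inE !eqxx !orbT.
- by rewrite inE eqxx.
by all_neqs.
Qed.

Lemma three_middles m1 m2 m3 x y z : p4_class ->
  uniq [:: m1; m2; m3] -> (forall m, m \in [:: m1; m2; m3] -> path4 x y m z) -> False.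
Proof.
move=> cl; rewrite /= !inE !negb_or -!andbA => /and4P[m12 m13 m23 _] h.
have [p1 p2 p3] : [/\ path4 x y m1 z, path4 x y m2 z & path4 x y m3 z].
  by rewrite !h ?inE ?eqxx ?orbT.
have /andP[/and5P[xy ym1 m1z xm1 yz] xz] := p1.
have /andP[/and5P[_ ym2 m2z xm2 _] _] := p2.
have /andP[/and5P[_ ym3 m3z xm3 _] _] := p3.
case: cl => cl.
  move/eqP: m23; apply; apply: (extendible_touches cl p1); try by all_neqs.
    by exists x, y, m2, z; rewrite p2 /= !inE !eqxx !orbT.
  by exists x, y, m3, z; rewrite p3 /= !inE !eqxx !orbT.
apply: (@sparse_unique [:: m1; m2; x; y; z] _ _ _ _ _ _ _ _ m1 cl _ _ p1 p2) => //.
- by all_neqs.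
- by rewrite /= !inE !eqxx !orbT.
- by rewrite /= !inE !eqxx !orbT.
- by rewrite !inE eqxx !orbT.
by all_neqs.
Qed.

Lemma conn_cut (U : {set G}) x y : ~~ disc G -> x \in U -> y \notin U ->
  exists u v, [/\ u \in U, v \notin U & adj u v].
Proof.
move=> nd xU yU; have [/existsP[u /existsP[v /and3P[]]]|] :=
  boolP [exists u, exists v, [&& u \in U, v \notin U & adj u v]]; first by exists u, v.
move=> /existsPn h; case/discP: nd; exists U; split; [by exists x|by exists y|].
by move=> u v uU vU; have /existsPn/(_ v) := h u; rewrite uU vU.
Qed.
End P4Classes.

Lemma compl_adjE (G : sgraph) (x y : G) :
  @adj (compl G) x y = (x != y) && ~~ adj x y.
Proof. by []. Qed.

Definition module (G : sgraph) (M : {set G}) :=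
  forall x m m', x \notin M -> m \in M -> m' \in M -> adj x m = adj x m'.

Lemma module_compl (G : sgraph) (M : {set G}) :
  @module (compl G) M -> module M.
Proof.
move=> h x m m' xM mM m'M; have := h x m m' xM mM m'M; rewrite !compl_adjE.
have -> : x != m by apply: contraNneq xM => ->.
have -> : x != m' by apply: contraNneq xM => ->.
by move/negb_inj.
Qed.

(* Take [n] complete to the module with as many neighbours as possible among
   the vertices [O] anticomplete to it. Some vertex of [O] misses [n] and is seen by
   another such vertex [n'], and by maximality [n'] misses a neighbour of [n]. *)
Lemma module_far_pair (G : sgraph) (M : {set G}) m1 m2 m3 : p4_class G ->
  ~~ disc G -> ~~ disc (compl G) -> module M ->
  uniq [:: m1; m2; m3] -> {subset [:: m1; m2; m3] <= M} -> M != setT ->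
  exists c c', [/\ c != c', ~~ adj c c', forall m, m \in M -> ~~ adj c m &
    forall m, m \in M -> ~~ adj c' m].
Proof.
move=> cl cG ccG modM um subM MT.
have m1M : m1 \in M by apply: subM; rewrite inE eqxx.
pose N := [set x | (x \notin M) && adj x m1].
pose O := [set x | (x \notin M) && ~~ adj x m1].
have NP n m : n \in N -> m \in M -> adj n m.
  by rewrite inE => /andP[nM nm1] mM; rewrite (modM _ _ _ nM mM m1M).
have OP x m : x \in O -> m \in M -> ~~ adj x m.
  by rewrite inE => /andP[xM xm1] mM; rewrite (modM _ _ _ xM mM m1M).
(* Otherwise [m n x x'] is a [P_4] for each of the three [m]. *)
have F1 n x x' : n \in N -> x \in O -> x' \in O -> adj x x' -> adj n x -> adj n x'.
  move=> nN xO x'O xx' nx; apply/negPn/negP => nx'.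
  apply: (@three_ends _ m1 m2 m3 n x x' cl um) => m /subM mM.
  have [nm [xm x'm]] := (NP _ _ nN mM, (OP _ _ xO mM, OP _ _ x'O mM)).
  by rewrite /path4; pattern_adj.
(* Otherwise [x n m n'] is a [P_4] for each of the three [m]. *)
have F2 n n' x : n \in N -> n' \in N -> x \in O -> n != n' -> ~~ adj n n' ->
    adj x n -> adj x n'.
  move=> nN n'N xO n_n' nn' xn; apply/negPn/negP => xn'.
  apply: (@three_middles _ m1 m2 m3 x n n' cl um) => m /subM mM.
  have [nm [xm n'm]] := (NP _ _ nN mM, (OP _ _ xO mM, NP _ _ n'N mM)).
  by rewrite /path4; pattern_adj.
have [y yM] : exists y, y \notin M.
  by move: MT; rewrite -subTset => /subsetPn[y _ yM]; exists y.
have [n0 n0N] : exists n, n \in N.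
  have [u [v [uM vM uv]]] := conn_cut cG m1M yM.
  by exists v; rewrite inE vM (modM v m1 u) // adj_sym.
pose nbO n := [set x in O | adj n x].
pose n := [arg max_(n > n0 in N) #|nbO n|].
have [nN maxn] : n \in N /\ forall n', n' \in N -> #|nbO n'| <= #|nbO n|.
  by rewrite /n; case: arg_maxnP.
have [/forall_inP nO|/forall_inPn[o oO no]] := boolP [forall x in O, adj n x].
  (* If [n] sees all of [O], co-connectedness fails: a vertex missed by some member of [U] is
     neither in the module nor in [O], and by [F2] it belongs to [U]. *)
  pose U := [set z in N | [forall x in O, adj z x]].
  have nU : n \in U by rewrite inE nN; apply/forall_inP.
  have m1U : m1 \notin U by rewrite !inE m1M.
  have [u [v [uU vU]]] := @conn_cut (compl G) U n m1 ccG nU m1U.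
  rewrite compl_adjE => /andP[u_v uv]; case/setIdP: (uU) => uN /forall_inP uO.
  have [vM|vM] := boolP (v \in M); first by rewrite NP in uv.
  have [vm|vm] := boolP (@adj G v m1); last first.
    by have := uO v; rewrite inE vM vm (negbTE uv) => /(_ isT).
  have vN : v \in N by rewrite inE vM.
  move: vU; rewrite inE vN => /forall_inPn[x xO].
  by rewrite adj_sym (F2 u v x) // adj_sym uO.
pose U := [set x in O | ~~ adj n x].
have oU : o \in U by rewrite inE oO.
have m1U : m1 \notin U by rewrite !inE m1M.
have [u [v [/setIdP[uO nu] vU uv]]] := conn_cut cG oU m1U.
have vM : v \notin M by apply/negP => vM; have := OP _ _ uO vM; rewrite uv.
have vN : v \in N.
  rewrite inE vM; apply/negPn/negP => vm.
  have vO : v \in O by rewrite inE vM.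
  have nv : adj n v by move: vU; rewrite inE vO negbK.
  by case/negP: nu; apply: (F1 n v u) => //; rewrite adj_sym.
have [x xn xv] : exists2 x, x \in nbO n & x \notin nbO v.
  apply/subsetPn; apply: contraL (maxn v vN) => sub; rewrite -ltnNge.
  apply: proper_card; rewrite properE sub; apply/subsetPn; exists u.
    by rewrite inE uO adj_sym.
  by rewrite inE uO.
case/setIdP: xn => xO nx.
exists u, x; split=> [||m mM|m mM].
- by neqs.
- by apply/negP => ux; case/negP: nu; apply: (F1 n x u) => //; rewrite adj_sym.
- exact: OP.
exact: OP.
Qed.

(** * Two disjoint edges in a connected graph *)

Section TwoDisjointEdges.
Variable G : sgraph.
Implicit Types (a b c d p q u v x y : G) (M P Q S : {set G}).

(** Every cut of [P] is crossed by an edge; as a boolean it can enter the choice of a largest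
    pair. *)
Definition connected_set P := [forall S : {set G},
  [exists x in P, x \in S] && [exists y in P, y \notin S] ==>
  [exists x in P, [exists y in P, [&& x \in S, y \notin S & adj x y]]]].

Lemma connected_setP P : reflect
  (forall S x y, x \in P -> y \in P -> x \in S -> y \notin S ->
     exists u v, [/\ u \in P, v \in P, u \in S, v \notin S & adj u v])
  (connected_set P).
Proof.
apply: (iffP forallP) => [h S x y xP yP xS yS|h S].
  have /implyP hS := h S.
  suff /hS/exists_inP[u uP /exists_inP[v vP /and3P[uS vS uv]]] :
    [exists x in P, x \in S] && [exists y in P, y \notin S] by exists u, v.
  by apply/andP; split; apply/exists_inP; [exists x|exists y].
apply/implyP => /andP[/exists_inP[x xP xS] /exists_inP[y yP yS]].
have [u [v [uP vP uS vS uv]]] := h S x y xP yP xS yS.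
by apply/exists_inP; exists u => //; apply/exists_inP; exists v => //; rewrite uS vS.
Qed.

Lemma connected_edge a b : adj a b -> connected_set [set a; b].
Proof.
move=> ab; apply/connected_setP => S x y /set2P[]-> /set2P[]-> xS yS.
- by rewrite xS in yS.
- by exists a, b; rewrite !set21 !set22.
- by exists b, a; rewrite !set21 !set22 adj_sym.
by rewrite xS in yS.
Qed.

Lemma connected_setU1 P p v : connected_set P -> p \in P -> adj v p ->
  connected_set (v |: P).
Proof.
move=> /connected_setP cP pP vp; apply/connected_setP => S x y xP yP xS yS.
have vV : v \in v |: P by rewrite setU11.
have PV u : u \in P -> u \in v |: P by move=> uP; rewrite in_setU1 uP orbT.
have [/exists_inP[x' x'P x'S]|nS] := boolP [exists u in P, u \in S]; last first.
  have pS : p \notin S by apply: contra nS => pS; apply/exists_inP; exists p.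
  case/setU1P: xP xS => [->|xP] xS; last first.
    by case/negP: nS; apply/exists_inP; exists x.
  by exists v, p; split => //; apply: PV.
have [/exists_inP[y' y'P y'S]|nS] := boolP [exists u in P, u \notin S]; last first.
  have pS : p \in S by apply: contraR nS => pS; apply/exists_inP; exists p.
  case/setU1P: yP yS => [->|yP] yS; last first.
    by case/negP: nS; apply/exists_inP; exists y.
  by exists p, v; split => //; [apply: PV|rewrite adj_sym].
have [u [w [uP wP uS wS uw]]] := cP S x' y' x'P y'P x'S y'S.
by exists u, w; split=> //; apply: PV.
Qed.

Lemma connected_has_edge P : connected_set P -> 1 < #|P| ->
  exists p q, [/\ p \in P, q \in P & adj p q].
Proof.
move=> /connected_setP cP /card_gt1P[x [y [xP yP xy]]].
have [] := cP [set x] x y xP yP; rewrite ?set11 ?inE ?[y == x]eq_sym //.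
by move=> u [v [uP vP _ _ uv]]; exists u, v.
Qed.

Definition linked P Q := [&& connected_set P, connected_set Q, 1 < #|P|, 1 < #|Q| &
  [forall x in P, forall y in Q, ~~ adj x y]].

Lemma linkedC P Q : linked P Q = linked Q P.
Proof.
have sym A B : [forall x in A, forall y in B, ~~ @adj G x y] ->
    [forall x in B, forall y in A, ~~ @adj G x y].
  move/forall_inP => h; apply/forall_inP => x xB; apply/forall_inP => y yA.
  by rewrite adj_sym; have /forall_inP := h y yA; apply.
by apply/and5P/and5P => -[? ? ? ? /sym].
Qed.

Lemma linked_setU1 P Q v p : linked P Q -> p \in P -> adj v p -> v \notin P ->
  (forall q, q \in Q -> ~~ adj v q) -> linked (v |: P) Q /\ #|v |: P| = #|P|.+1.
Proof.
move=> /and5P[cP cQ P1 Q1 /forall_inP sep] pP vp vP vQ; split; last by rewrite cardsU1 vP.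
apply/and5P; split=> //; first exact: connected_setU1 vp.
  by rewrite cardsU1 vP; apply: leqW.
apply/forall_inP => x /setU1P[->|/sep//]; exact/forall_inP.
Qed.

(* [p' p v q q'] is an induced [P_5], or a complement of the banner when [v] sees [q']. *)
Definition is_tail p' p v q q' :=
  [&& adj p' p, adj p v, adj v q, adj q q' & ~~ adj p' v] &&
  [&& ~~ adj p' q, ~~ adj p' q', ~~ adj p q & ~~ adj p q'].

(* A largest pair of separated connected sets with edges is a module, unless some
   vertex sees both sides without being complete to them. *)
Lemma two_disjoint_edges a b c d : ~~ disc G -> is_2K2 a b c d ->
  (exists p' p v q q', is_tail p' p v q q') \/
  (exists M a b c d, [/\ module M, M != setT, is_2K2 a b c d &
     {subset [:: a; b; c; d] <= M}]).
Proof.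
move=> cG /and5P[ab cd ac ad /andP[bc bd]].
have l0 : linked [set a; b] [set c; d].
  apply/and5P; split; try exact: connected_edge.
  - by rewrite cards2; have -> : a != b by neqs.
  - by rewrite cards2; have -> : c != d by neqs.
  apply/forall_inP => x xP; apply/forall_inP => y yQ.
  by case/set2P: xP => ->; case/set2P: yQ => ->.
pose ok (S : {set G} * {set G}) := linked S.1 S.2.
pose PQ := [arg max_(S > ([set a; b], [set c; d]) | ok S) (#|S.1| + #|S.2|)].
have [lPQ maxPQ] : ok PQ /\ forall S : {set G} * {set G}, ok S ->
    #|S.1| + #|S.2| <= #|PQ.1| + #|PQ.2|.
  by rewrite /PQ; case: arg_maxnP.
move: PQ lPQ maxPQ => [P Q] lPQ max.
have {max} max P' Q' : linked P' Q' -> #|P'| + #|Q'| <= #|P| + #|Q|.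
  exact: (max (P', Q')).
rewrite /ok /= in lPQ; have /and5P[cP cQ P1 Q1 /forall_inP sep] := lPQ.
have sepPQ x y : x \in P -> y \in Q -> ~~ adj x y.
  by move=> xP yQ; have /forall_inP := sep x xP; apply.
(* A vertex attached to [P] alone could be added to [P], against maximality. *)
have toQ v p : v \notin P -> p \in P -> adj v p -> exists2 q, q \in Q & adj v q.
  move=> vP pP vp; have [/exists_inP//|/exists_inPn none] := boolP [exists q in Q, adj v q].
  have [/max + E] := linked_setU1 lPQ pP vp vP none.
  by rewrite E addSn ltnn.
have toP v q : v \notin Q -> q \in Q -> adj v q -> exists2 p, p \in P & adj v p.
  move=> vQ qQ vq; have [/exists_inP//|/exists_inPn none] := boolP [exists p in P, adj v p].
  rewrite linkedC in lPQ; have [] := linked_setU1 lPQ qQ vq vQ none.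
  by rewrite linkedC => /max + E; rewrite E addnS ltnn.
have attach P' v x y : connected_set P' -> x \in P' -> y \in P' -> adj v x -> ~~ adj v y ->
    exists p p', [/\ p \in P', p' \in P', adj v p, ~~ adj v p' & adj p p'].
  move=> /connected_setP cP' xP yP vx vy.
  have [||u [w]] := cP' [set z | adj v z] x y xP yP; rewrite ?inE // => -[uP wP].
  by move=> vu vw uw; exists u, w.
(* Either the union is a module, or some outside [v] distinguishes two of its vertices; by [toQ] and
   [toP] such a [v] sees both sides. *)
have [/forall_inP full|/forall_inPn[v vPQ /forall_inPn[x xPQ /forall_inPn[y yPQ]]]] :=
    boolP [forall v in ~: (P :|: Q), forall x in P :|: Q, forall y in P :|: Q,
      adj v x ==> adj v y].
  right; have [p [p' [pP p'P pp']]] := connected_has_edge cP P1.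
  have [q [q' [qQ q'Q qq']]] := connected_has_edge cQ Q1.
  exists (P :|: Q), p, p', q, q'; split.
  - move=> v x y vPQ xPQ yPQ; have vC : v \in ~: (P :|: Q) by rewrite inE.
    have imp u w : u \in P :|: Q -> w \in P :|: Q -> adj v u -> adj v w.
      move=> uPQ wPQ; apply/implyP; move: w wPQ; apply/forall_inP.
      by move: u uPQ; apply/forall_inP; apply: full.
    by apply/idP/idP; apply: imp.
  - apply/eqP => PQT.
    have qP : q \notin P.
      by apply/negP => qP; have := sepPQ _ _ qP q'Q; rewrite qq'.
    have [u [v [uP vP uv]]] := conn_cut cG pP qP.
    have : v \in P :|: Q by rewrite PQT inE.
    by rewrite in_setU (negbTE vP) => /(sepPQ _ _ uP); rewrite uv.
  - by rewrite /is_2K2 pp' qq' !sepPQ.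
  by move=> z; rewrite !inE => /or4P[] /eqP->; rewrite ?pP ?p'P ?qQ ?q'Q ?orbT.
rewrite negb_imply => /andP[vx vy]; left; move: vPQ; rewrite in_setC in_setU negb_or.
case/andP=> vP vQ.
have [[p pP vp] [q qQ vq]] : (exists2 p, p \in P & adj v p) /\ (exists2 q, q \in Q & adj v q).
  case/setUP: xPQ => [xP|xQ]; split.
  - by exists x.
  - exact: toQ vx.
  - exact: toP vx.
  - by exists x.
(* On the side that [v] sees partially an edge leads from a neighbour to a non-neighbour; on the
   other side any edge starting at a neighbour will do, whence the two shapes of a tail. *)
have tail P' Q' x' y' q1 : connected_set P' -> connected_set Q' -> 1 < #|Q'| ->
    (forall u w, u \in P' -> w \in Q' -> ~~ adj u w) -> x' \in P' -> y' \in P' ->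
    adj v x' -> ~~ adj v y' -> q1 \in Q' -> adj v q1 ->
    exists p' p v q q', is_tail p' p v q q'.
  move=> cP' cQ' Q'1 sep' x'P y'P vx' vy' q1Q vq1.
  have [u [u' [uP u'P vu vu' uu']]] := attach P' v x' y' cP' x'P y'P vx' vy'.
  have [w [w' [wQ w'Q vw ww']]] : exists w w', [/\ w \in Q', w' \in Q', adj v w & adj w w'].
    have [/forall_inP all|/forall_inPn[q2 q2Q vq2]] := boolP [forall w in Q', adj v w].
      have [w [w' [wQ w'Q ww']]] := connected_has_edge cQ' Q'1.
      by exists w, w'; rewrite all.
    have [w [w' [wQ w'Q vw _ ww']]] := attach Q' v q1 q2 cQ' q1Q q2Q vq1 vq2.
    by exists w, w'.
  have [[uw uw'] [u'w u'w']] := ((sep' _ _ uP wQ, sep' _ _ uP w'Q),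
    (sep' _ _ u'P wQ, sep' _ _ u'P w'Q)).
  by exists u', u, v, w, w'; rewrite /is_tail; pattern_adj.
case/setUP: yPQ => [yP|yQ].
  exact: (tail P Q p y q).
apply: (tail Q P q y p) => // u w uQ wP.
by rewrite adj_sym; apply: sepPQ.
Qed.
End TwoDisjointEdges.

Section Tails.
Variable G : sgraph.
Implicit Types (a b c d p q u v x y : G) (M P Q S R : {set G}).

(** Of the sixteen traces of [u] on the path, thirteen create a second [P_4]; the other three are
    nothing, the two middle vertices, and everything. *)
Lemma path4_type a b c d u : path4 a b c d -> u \notin [:: a; b; c; d] ->
  touches [:: a; b; c; d] u \/
  [/\ adj u d = adj u a, adj u c = adj u b & adj u a -> adj u b].
Proof.
move=> /andP[/and5P[ab bc cd ac bd] ad] uW.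
have T x y z w : path4 x y z w -> u \in [:: x; y; z; w] ->
    has (mem [:: a; b; c; d]) [:: x; y; z; w] -> touches [:: a; b; c; d] u.
  by move=> ? ? ?; exists x, y, z, w.
have [ua|ua] := boolP (adj u a); have [ub|ub] := boolP (adj u b);
have [uc|uc] := boolP (adj u c); have [ud|ud] := boolP (adj u d);
  try (by right; split; adjs); left;
  [> apply: (T a u c d) | apply: (T c d u a) | apply: (T u b c d)
   | apply: (T b a u d) | apply: (T d c u a) | apply: (T u a b c)
   | apply: (T u a b c) | apply: (T d u b a)
   | apply: (T a b u d) | apply: (T u b c d)
   | apply: (T u c b a) | apply: (T u c b a) | apply: (T u d c b) ];
  try (by rewrite /= !inE !eqxx ?orbT); rewrite /path4; pattern_adj.
Qed.

(** A tail carries two [P_4]s on five vertices, so sparse graphs have none. In an extendible graph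
    the one vertex allowed outside each of these paths is already in the tail; the other vertices of
    [G] see none or all of it, or exactly [p] and [v], and those of the last kind form [R]. *)
Lemma tail_module p' p v q q' : p4_class G -> is_tail p' p v q q' ->
  exists R, [/\ module (R :|: [set x in [:: p'; p; v; q; q']]),
    forall r, r \in R -> [/\ adj r p, adj r v, ~~ adj r p', ~~ adj r q & ~~ adj r q'] &
    ~~ adj v q' -> R = set0].
Proof.
move=> cl /andP[/and5P[p'p pv vq qq' p'v] /and4P[p'q p'q' pq pq']].
set D := [:: p'; p; v; q; q'].
have W1 : path4 p' p v q by rewrite /path4; pattern_adj.
have W2 : ~~ adj v q' -> path4 p v q q' by move=> vq'; rewrite /path4; pattern_adj.
have W2' : adj v q' -> path4 p' p v q' by move=> vq'; rewrite /path4; pattern_adj.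
have uD : uniq D by all_neqs.
have in1 x : x \notin D -> x \notin [:: p'; p; v; q].
  by apply: contra; rewrite !inE => /or4P[]->; rewrite ?orbT.
have in2 x : x \notin D -> x \notin [:: p; v; q; q'].
  by apply: contra; rewrite !inE => /or4P[]->; rewrite ?orbT.
have in2' x : x \notin D -> x \notin [:: p'; p; v; q'].
  by apply: contra; rewrite !inE => /or4P[]->; rewrite ?orbT.
case: cl => [ext|sp]; last first.
  have [vq'|vq'] := boolP (adj v q').
    case: (@sparse_unique _ D _ _ _ _ _ _ _ _ q sp _ uD W1 (W2' vq')) => //=;
      rewrite ?inE ?eqxx ?orbT //; by all_neqs.
  case: (@sparse_unique _ D _ _ _ _ _ _ _ _ p' sp _ uD W1 (W2 vq')) => //=;
    rewrite ?inE ?eqxx ?orbT //; by all_neqs.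
have q'W1 : q' \notin [:: p'; p; v; q] by all_neqs.
have tq' : touches [:: p'; p; v; q] q'.
  have [vq'|vq'] := boolP (adj v q').
    by exists p', p, v, q'; rewrite W2' //= !inE !eqxx !orbT.
  by exists p, v, q, q'; rewrite W2 //= !inE !eqxx !orbT.
have nt1 x : x \notin D -> ~ touches [:: p'; p; v; q] x.
  move=> xD t; have := extendible_touches ext W1 (in1 _ xD) q'W1 t tq'.
  by move=> E; move: xD; rewrite E !inE eqxx !orbT.
(* A [P_4] meeting the tail in [q'] alone is handled by the second path, whose extra vertex is [q]
   or [p']. *)
have nt x : x \notin D -> ~ touches D x.
  move=> xD [a [b [c [d [P4 xP /hasP[y yP yD]]]]]].
  have [y1|y1] := boolP (y \in [:: p'; p; v; q]).
    by apply: (nt1 x xD); exists a, b, c, d; split=> //; apply/hasP; exists y.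
  have yq' : y = q'.
    by move: yD y1; rewrite !inE => /or4P[/eqP->|/eqP->|/eqP->|/orP[/eqP->|/eqP->]];
      rewrite ?eqxx ?orbT.
  subst y; have [vq'|vq'] := boolP (adj v q').
    have qW : q \notin [:: p'; p; v; q'] by all_neqs.
    have tq : touches [:: p'; p; v; q'] q.
      by exists p', p, v, q; rewrite W1 /= !inE !eqxx !orbT.
    have tx : touches [:: p'; p; v; q'] x.
      exists a, b, c, d; split=> //; apply/hasP; exists q' => //.
      by rewrite !inE eqxx !orbT.
    have E := extendible_touches ext (W2' vq') (in2' _ xD) qW tx tq.
    by move: xD; rewrite E !inE eqxx !orbT.
  have pW : p' \notin [:: p; v; q; q'] by all_neqs.
  have tp : touches [:: p; v; q; q'] p'.
    by exists p', p, v, q; rewrite W1 /= !inE !eqxx !orbT.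
  have tx : touches [:: p; v; q; q'] x.
    exists a, b, c, d; split=> //; apply/hasP; exists q' => //.
    by rewrite !inE eqxx !orbT.
  have E := extendible_touches ext (W2 vq') (in2 _ xD) pW tx tp.
  by move: xD; rewrite E !inE eqxx.
pose none x := [&& ~~ adj x p', ~~ adj x p, ~~ adj x v, ~~ adj x q & ~~ adj x q'].
pose every x := [&& adj x p', adj x p, adj x v, adj x q & adj x q'].
pose mid x := [&& adj x p, adj x v, ~~ adj x p', ~~ adj x q & ~~ adj x q'].
have type x : x \notin D -> [\/ none x, every x | mid x && adj v q'].
  move=> xD; case: (path4_type W1 (in1 _ xD)) => [/(nt1 x xD)//|[e1 e2 e3]].
  have [vq'|vq'] := boolP (adj v q').
    case: (path4_type (W2' vq') (in2' _ xD)) => [t|[e4 _ _]].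
      case: (nt x xD); case: t => a [b [c [d [P4 xP /hasP[y yP yW]]]]].
      exists a, b, c, d; split=> //; apply/hasP; exists y => //.
      by move: yW; rewrite !inE => /or4P[]->; rewrite ?orbT.
    rewrite /none /every /mid e1 e2 e4 andbT; move: e3.
    case: (adj x p') => [->//|_]; first by constructor 2.
    by case: (adj x p); [constructor 3|constructor 1].
  case: (path4_type (W2 vq') (in2 _ xD)) => [t|[e4 e5 e6]].
    case: (nt x xD); case: t => a [b [c [d [P4 xP /hasP[y yP yW]]]]].
    exists a, b, c, d; split=> //; apply/hasP; exists y => //.
    by move: yW; rewrite !inE => /or4P[]->; rewrite ?orbT.
  rewrite /none /every /mid e4 andbF; move: e5; rewrite e1 e2 => <-.
  by case: (adj x p'); [constructor 2|constructor 1].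
pose R := [set x | (x \notin D) && mid x].
have midP x : x \in R -> mid x by rewrite inE => /andP[].
exists R; split=> [x m m' xM mM m'M|r /midP/and5P[]//|vq']; last first.
  apply/setP => x; rewrite inE in_set0; apply/negbTE; apply/negP => /andP[xD xm].
  case: (type x xD) => [/and5P[_ n _ _ _]|/and5P[a _ _ _ _]|/andP[_ h]].
  - by case/and5P: xm => a _ _ _ _; rewrite a in n.
  - by case/and5P: xm => _ _ n _ _; rewrite a in n.
  by rewrite h in vq'.
move: xM; rewrite in_setU negb_or [x \in [set _ in _]]in_set => /andP[xR xD].
(* A vertex of another type that sees [R] differently from the tail would lie on a [P_4] meeting the
   tail. *)
have inT y a b c d z : y \notin D -> z \in D -> path4 a b c d ->
    y \in [:: a; b; c; d] -> z \in [:: a; b; c; d] -> False.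
  move=> yD zD P4 yP zP; apply: (nt y yD); exists a, b, c, d; split=> //.
  by apply/hasP; exists z.
case: (type x xD) => [xn|xe|/andP[xm _]]; last by move: xR; rewrite inE xD xm.
  suff xm z : z \in R :|: [set x in D] -> adj x z = false by rewrite !xm.
  have /and5P[xp' xp xv xq xq'] := xn.
  case/setUP => [|]; last first.
    rewrite in_set !inE => /or4P[/eqP->|/eqP->|/eqP->|/orP[/eqP->|/eqP->]]; exact/negbTE.
  move=> zR; have zD : z \notin D by move: zR; rewrite inE => /andP[].
  have /and5P[zp zv zp' zq zq'] := midP z zR.
  apply/negbTE/negP => xz; apply: (@inT x x z p p' p xD); rewrite ?inE ?eqxx ?orbT //.
  by rewrite /path4; pattern_adj.
suff xm z : z \in R :|: [set x in D] -> adj x z by rewrite !xm.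
have /and5P[xp' xp xv xq xq'] := xe.
case/setUP => [|]; last first.
  by rewrite in_set !inE => /or4P[/eqP->|/eqP->|/eqP->|/orP[/eqP->|/eqP->]].
move=> zR; have zD : z \notin D by move: zR; rewrite inE => /andP[].
have /and5P[zp zv zp' zq zq'] := midP z zR.
apply/negPn/negP => xz; apply: (@inT x z v x p' p' xD); rewrite ?inE ?eqxx ?orbT //.
by rewrite /path4; pattern_adj.
Qed.
End Tails.

(** * Connected and co-connected obstructions *)

Lemma two_parts_polar (G : sgraph) (A1 A2 : {set G}) :
  {in A1 &, forall x y, ~~ adj x y} -> {in A2 &, forall x y, ~~ adj x y} ->
  {in A1 & A2, forall x y, adj x y} ->
  (forall x y, x \notin A1 -> x \notin A2 -> y \notin A1 -> y \notin A2 ->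
    x != y -> adj x y) -> spolar 2 [set: G].
Proof.
move=> s1 s2 s12 cB; apply/spolarP.
exists (fun x => if x \in A1 then 0 else if x \in A2 then 1 else 2) => x y _ _.
  case: ifP => x1; [|case: ifP => x2 //]; (case: ifP => y1; [|case: ifP => y2 //]) => _ _.
  - exact/negbTE/s1.
  - exact: s12.
  - by rewrite adj_sym; apply: s12.
  exact/negbTE/s2.
case: ifP => x1 //; case: ifP => x2 //; case: ifP => y1 //; case: ifP => y2 // _ _.
by apply: cB; rewrite ?x1 ?x2 ?y1 ?y2.
Qed.

Section ConnectedObstruction.
Variables (G : sgraph) (s : nat).
Hypotheses (s2 : 2 <= s) (mG : min_spolar_obs s [set: G]).
Hypotheses (cl : p4_class G) (ccl : p4_class (compl G)).
Hypotheses (cG : ~~ disc G) (ccG : ~~ disc (compl G)).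

Lemma not_two_polar : ~ spolar 2 [set: G].
Proof. by move=> /(spolar_leq s2); case/min_spolar_obsP: mG. Qed.

Lemma no_pattern (t : seq G) : uniq t -> upper t \in sporadic_tables -> False.
Proof.
by move=> ut /(sporadic_match mG ut)/sporadic_disc; apply/negP.
Qed.

Lemma no_2K2_module (M : {set G}) a b c d : module M -> M != setT ->
  is_2K2 a b c d -> {subset [:: a; b; c; d] <= M} -> False.
Proof.
move=> mM MT /and5P[ab cd ac ad /andP[bc bd]] sub.
have abc : uniq [:: a; b; c] by all_neqs.
have sabc : {subset [:: a; b; c] <= M}.
  by move=> x xs; apply: sub; move: xs; rewrite !inE => /or3P[]->; rewrite ?orbT.
have [z [_ [_ _ zM _]]] := module_far_pair cl cG ccG mM abc sabc MT.
have [aM bM cM dM] : [/\ a \in M, b \in M, c \in M & d \in M].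
  by split; apply: sub; rewrite !inE eqxx ?orbT.
have [[za zb] [zc zd]] := ((zM _ aM, zM _ bM), (zM _ cM, zM _ dM)).
by apply: (@no_pattern [:: z; a; b; c; d]); [all_neqs|rewrite /=; adjs].
Qed.

(** One far vertex gives only [K_1 + C_4], which is polar; the second completes [2K_1 + C_4], which
    is why a far pair is needed. *)
Lemma no_C4_module (M : {set G}) a b c d : module M -> M != setT ->
  is_C4 a b c d -> {subset [:: a; b; c; d] <= M} -> False.
Proof.
move=> mM MT /and5P[ab bc cd da /and4P[ac bd a_c b_d]] sub.
have abc : uniq [:: a; b; c] by all_neqs.
have sabc : {subset [:: a; b; c] <= M}.
  by move=> x xs; apply: sub; move: xs; rewrite !inE => /or3P[]->; rewrite ?orbT.
have [z [w [z_w zw zM wM]]] := module_far_pair cl cG ccG mM abc sabc MT.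
have [aM bM cM dM] : [/\ a \in M, b \in M, c \in M & d \in M].
  by split; apply: sub; rewrite !inE eqxx ?orbT.
have [[za zb] [zc zd]] := ((zM _ aM, zM _ bM), (zM _ cM, zM _ dM)).
have [[wa wb] [wc wd]] := ((wM _ aM, wM _ bM), (wM _ cM, wM _ dM)).
by apply: (@no_pattern [:: z; w; a; b; c; d]); [all_neqs|rewrite /=; adjs].
Qed.

Lemma no_C5 a b c d e : @is_C5 G a b c d e -> False.
Proof.
move=> /andP[/and5P[ab bc cd de ea] /and5P[ac ad bd be ce]].
have ut : uniq [:: a; b; c; d; e] by all_neqs.
have P1 : path4 a b c d by rewrite /path4; pattern_adj.
have P2 : path4 b c d e by rewrite /path4; pattern_adj.
have P3 : path4 c d e a by rewrite /path4; pattern_adj.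
case: cl => [ext|sp]; last first.
  case: (@sparse_unique _ [:: a; b; c; d; e] _ _ _ _ _ _ _ _ a sp _ ut P1 P2) => //=;
    rewrite ?inE ?eqxx ?orbT //; by all_neqs.
pose M := [set x in [:: a; b; c; d; e]].
(* The path [x y z w] has its one extra vertex [r] on the cycle, so [u] sees its ends alike and its
   middles alike. Three consecutive paths make [u] see all five vertices alike. *)
have key (x y z w r u : G) : path4 x y z w -> path4 y z w r -> r \notin [:: x; y; z; w] ->
    u \notin [:: x; y; z; w; r] -> [/\ adj u w = adj u x & adj u z = adj u y].
  move=> Px Py rW uM; have uW : u \notin [:: x; y; z; w].
    by apply: contra uM; rewrite !inE => /or4P[]->; rewrite ?orbT.
  have [t|[]//] := path4_type Px uW.
  have tr : touches [:: x; y; z; w] r.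
    by exists y, z, w, r; rewrite Py /= !inE !eqxx ?orbT.
  by move: uM; rewrite (extendible_touches ext Px uW rW t tr) !inE eqxx !orbT.
have mM : module M.
  move=> u; rewrite /M inE => m m' uM.
  have [|e1 e2] := key _ _ _ _ _ _ P1 P2 _ uM; first by all_neqs.
  have [||e3 e4] := key b c d e a u P2 P3.
  - by all_neqs.
  - by apply: contra uM; rewrite !inE => /or4P[|||/orP[]]->; rewrite ?orbT.
  have [|||e5 e6] := key c d e a b u P3.
  - by rewrite /path4; pattern_adj.
  - by all_neqs.
  - by apply: contra uM; rewrite !inE => /or4P[|||/orP[]]->; rewrite ?orbT.
  have E m0 : m0 \in M -> adj u m0 = adj u a.
    rewrite /M !inE => /or4P[/eqP->//|/eqP->|/eqP->|/orP[/eqP->|/eqP->]] //.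
    - by rewrite -e2 -e5.
    - by rewrite e3 -e2 -e5.
  by move=> mM m'M; rewrite !E // inE.
have [MT|MT] := eqVneq M setT; last first.
  have abc : uniq [:: a; b; c] by all_neqs.
  have sabc : {subset [:: a; b; c] <= M}.
    by move=> x; rewrite !inE => /or3P[]->; rewrite ?orbT.
  have [z [_ [_ _ zM _]]] := module_far_pair cl cG ccG mM abc sabc MT.
  have [[za zb] [zc [zd ze]]] : (~~ adj z a /\ ~~ adj z b) /\
      (~~ adj z c /\ (~~ adj z d /\ ~~ adj z e)).
    by split; [split|split; [|split]]; apply: zM; rewrite !inE eqxx ?orbT.
  by apply: (@no_pattern [:: z; a; b; c; d; e]); [all_neqs|rewrite /=; adjs].
(* The 5-cycle itself has parts [{a, c}], [{b}] and clique [{d, e}]. *)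
apply: not_two_polar; apply: (@two_parts_polar _ [set a; c] [set b]).
- by move=> x y /set2P[]-> /set2P[]->; adjs; rewrite ?adj_irrefl.
- by move=> x y /set1P-> /set1P->; rewrite adj_irrefl.
- by move=> x y /set2P[]-> /set1P->; adjs.
have de_ x : x \notin [set a; c] -> x \notin [set b] -> x \in [set d; e].
  have : x \in M by rewrite MT.
  rewrite !inE => /or4P[||| /orP[]] ->; rewrite ?orbT //.
move=> x y /de_ h /h /set2P[]-> /de_ k /k /set2P[]->; adjs; rewrite ?eqxx //.
Qed.

Lemma no_connected_obstruction : False.
Proof.
have ns : ~~ spolar 1 [set: G] by apply/negP => /(@spolar_leq _ 1 2 _ isT)/not_two_polar.
have [] := foldes_hammer ns.
- move=> [a [b [c [d K]]]].
  have [[p' [p [v [q [q' T]]]]]|] := two_disjoint_edges cG K; last first.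
    by move=> [M [a' [b' [c' [d' [mM MT K' sub]]]]]]; apply: (no_2K2_module mM MT K').
  have [R [mM RP Rv]] := tail_module cl T.
  have /andP[/and5P[p'p pv vq qq' p'v] /and4P[p'q p'q' pq pq']] := T.
  have [MT|MT] := eqVneq (R :|: [set x in [:: p'; p; v; q; q']]) setT; last first.
    apply: (no_2K2_module mM MT (a := p') (b := p) (c := q) (d := q')).
      by rewrite /is_2K2; pattern_adj.
    by move=> x; rewrite !inE => /or4P[]->; rewrite ?orbT.
  (* An edge inside [R] together with [qq'] and [p'] would be a [K_1 + 2K_2]. *)
  have Rst : {in R &, forall x y, ~~ adj x y}.
    move=> x y xR yR; apply/negP => xy.
    have [[xp xv xp' xq xq'] [yp yv yp' yq yq']] := (RP x xR, RP y yR).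
    by apply: (@no_pattern [:: p'; x; y; q; q']); [all_neqs|rewrite /=; adjs].
  have cover x : [|| x \in R, x == p', x == p, x == v, x == q | x == q'].
    by have : x \in [set: G] by []; rewrite -MT !inE.
  apply: not_two_polar; have [vq'|vq'] := boolP (adj v q').
    apply: (@two_parts_polar _ [set p] (p' |: R)).
    - by move=> x y /set1P-> /set1P->; rewrite adj_irrefl.
    - move=> x y /setU1P[->|xR] /setU1P[->|yR]; rewrite ?adj_irrefl //.
      + by rewrite adj_sym; case: (RP y yR).
      + by case: (RP x xR).
      exact: Rst.
    - move=> x y /set1P-> /setU1P[->|yR]; rewrite adj_sym //.
      by case: (RP y yR).
    have B x : x \notin [set p] -> x \notin p' |: R -> [|| x == v, x == q | x == q'].
      by have := cover x; rewrite !inE; case: (x \in R); case: (x == p'); case: (x == p).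
    move=> x y /B h /h xB /B k /k yB.
    by case/or3P: xB => /eqP->; case/or3P: yB => /eqP->; adjs; rewrite ?eqxx.
  have R0 := Rv vq'; apply: (@two_parts_polar _ [set p] [set p'; v]).
  - by move=> x y /set1P-> /set1P->; rewrite adj_irrefl.
  - by move=> x y /set2P[]-> /set2P[]->; adjs; rewrite ?adj_irrefl.
  - by move=> x y /set1P-> /set2P[]->; adjs.
  have B x : x \notin [set p] -> x \notin [set p'; v] -> (x == q) || (x == q').
    by have := cover x; rewrite R0 !inE; case: (x == v); case: (x == p'); case: (x == p).
  move=> x y /B h /h xB /B k /k yB.
  by case/orP: xB => /eqP->; case/orP: yB => /eqP->; adjs; rewrite ?eqxx.
- move=> [a [b [c [d /and5P[ab bc cd da /and4P[ac bd a_c b_d]]]]]].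
  have toC (x y : G) : x != y -> ~~ adj x y -> @adj (compl G) x y.
    by rewrite compl_adjE => -> ->.
  have toCn (x y : G) : adj x y -> ~~ @adj (compl G) x y.
    by rewrite compl_adjE negb_and negbK => ->; rewrite orbT.
  have ofC (x y : G) : @adj (compl G) x y -> ~~ adj x y.
    by rewrite compl_adjE => /andP[].
  have ofCn (x y : G) : x != y -> ~~ @adj (compl G) x y -> adj x y.
    by rewrite compl_adjE => -> /=; rewrite negbK.
  (* A [C_4] is a [2K_2] of the complement, so the growth argument is run there and its outcome is
     translated back. *)
  have K : @is_2K2 (compl G) a c b d.
    apply/and5P; split; [exact: toC|exact: toC|exact: toCn| |apply/andP; split];
      try exact: toCn; by apply: toCn; rewrite adj_sym.
  have toC4 a' b' c' d' : @is_2K2 (compl G) a' b' c' d' -> @is_C4 G a' c' b' d'.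
    move=> /and5P[ab' cd' ac' ad' /andP[bc' bd']].
    have [n1 n2] : a' != b' /\ c' != d' by split; neqs.
    have [n3 n4] : a' != c' /\ a' != d' by split; neqs.
    have [n5 n6] : b' != c' /\ b' != d' by split; neqs.
    have h1 : @adj G a' c' by apply: ofCn.
    have h2 : @adj G c' b' by rewrite adj_sym; apply: ofCn.
    have h3 : @adj G b' d' by apply: ofCn.
    have h4 : @adj G d' a' by rewrite adj_sym; apply: ofCn.
    have [h5 h6] := (ofC _ _ ab', ofC _ _ cd').
    by rewrite /is_C4 h1 h2 h3 h4 h5 h6 n1 n2.
  have [[p' [p [v [q [q' T]]]]]|] := two_disjoint_edges ccG K; last first.
    move=> [M [a' [b' [c' [d' [mM MT K' sub]]]]]].
    apply: (no_C4_module (module_compl mM) MT (toC4 _ _ _ _ K')) => x.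
    by rewrite !inE => xs; apply: sub; rewrite !inE; case/or4P: xs => ->; rewrite ?orbT.
  have [R [mM RP Rv]] := tail_module ccl T.
  have /andP[/and5P[p'p pv vq qq' p'v] /and4P[p'q p'q' pq pq']] := T.
  have ut : uniq [:: p'; p; v; q; q'] by all_neqs.
  have [MT|MT] := eqVneq (R :|: [set x in [:: p'; p; v; q; q']]) setT; last first.
    apply: (no_C4_module (module_compl mM) MT (a := p') (b := q) (c := p) (d := q')).
      by apply: toC4; rewrite /is_2K2; pattern_adj.
    by move=> x; rewrite !inE => /or4P[]->; rewrite ?orbT.
  have {}RP (r : G) : r \in R -> [/\ ~~ adj r p, ~~ adj r v, adj r p', adj r q & adj r q'].
    move=> /RP[rp rv rp' rq rq']; split; try exact: ofC.
    - by apply: ofCn => //; neqs.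
    - by apply: ofCn => //; neqs.
    by apply: ofCn => //; neqs.
  have q_q' : q != q' :> G by neqs.
  have {p'p pv vq qq' p'v p'q p'q' pq pq' T ut}
    [[[p'p pv] [vq qq']] [p'v [[p'q p'q'] [pq pq']]]] :
      ((~~ @adj G p' p /\ ~~ @adj G p v) /\ (~~ @adj G v q /\ ~~ @adj G q q')) /\
      (@adj G p' v /\ ((@adj G p' q /\ @adj G p' q') /\ (@adj G p q /\ @adj G p q'))).
    move: ut; rewrite /= !inE !negb_or -!andbA => /and5P[? ? ? ? /and5P[? ? ? ? /andP[? _]]].
    by do !split; try exact: ofC; apply: ofCn.
  have Rst : {in R &, forall x y, ~~ @adj G x y}.
    move=> x y xR yR; apply/negP => xy.
    have [[xp xv xp' xq xq'] [yp yv yp' yq yq']] := (RP x xR, RP y yR).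
    have vq' : ~~ @adj G v q'.
      apply/negP => h; have R0 := Rv (toCn _ _ h); by move: xR; rewrite R0 inE.
    (* The cycle [q x q' p] with [y] seeing all but [p], and [v] isolated from it: [K_1] plus the
       complement of [P_3 + K_2]. *)
    by apply: (@no_pattern [:: (v : G); q : G; x; q' : G; p : G; y]);
      [all_neqs|rewrite /=; adjs].
  have cover (x : G) : [|| x \in R, x == p', x == p, x == v, x == q | x == q'].
    by have : x \in [set: G] by []; rewrite -MT !inE.
  apply: not_two_polar; apply: (@two_parts_polar G [set (q : G); q' : G] ((p : G) |: R)).
  - by move=> x y /set2P[]-> /set2P[]->; adjs; rewrite ?adj_irrefl.
  - move=> x y /setU1P[->|xR] /setU1P[->|yR]; rewrite ?adj_irrefl //.
    + by rewrite adj_sym; case: (RP y yR).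
    + by case: (RP x xR).
    exact: Rst.
  - move=> x y /set2P[]-> /setU1P[->|yR]; rewrite adj_sym //; by case: (RP y yR).
  have B (x : G) : x \notin [set (q : G); q' : G] -> x \notin (p : G) |: R ->
      (x == p') || (x == v).
    by have := cover x; rewrite !inE; case: (x \in R); case: (x == q); case: (x == q');
      case: (x == p); rewrite ?orbF ?orbT.
  move=> x y /B h /h xB /B k /k yB.
  by case/orP: xB => /eqP->; case/orP: yB => /eqP->; adjs; rewrite ?eqxx.
by move=> [a [b [c [d [e /no_C5]]]]].
Qed.
End ConnectedObstruction.

(** * Minimal obstructions become polar with one more part *)

Section Threshold.
Variable G : sgraph.
Implicit Types (a b c d e x y : G) (X : {set G}).

(** With one part only the stable side matters, and a split partition becomes a truth assignment. *)
Lemma spolar1_bits X : spolar 1 X -> exists f : G -> bool,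
  {in X &, forall x y, adj x y -> ~~ (f x && f y)} /\
  {in X &, forall x y, x != y -> ~~ adj x y -> f x || f y}.
Proof.
case/spolarP => f fA fB; exists (fun x => f x == 0); split=> x y xX yX.
  move=> xy; apply/negP => /andP[/eqP x0 /eqP y0].
  by have := fA x y xX yX; rewrite x0 y0 xy => /(_ isT isT).
move=> x_y; apply: contraR; rewrite negb_or -!lt0n => /andP[x0 y0].
exact: fB.
Qed.

Lemma small_obstruction s X : min_spolar_obs s [set: G] -> ~ spolar s X -> X = setT.
Proof.
move=> /min_spolar_obsP[_ h] nX; apply/eqP; rewrite -subTset.
apply/negPn/negP => XT; apply: nX; apply: h.
by rewrite properE subsetT.
Qed.

(** By minimality [G] is exactly the [2K_2], [C_4] or [C_5] it contains, and each of these is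
    (2,1)-polar. *)
Lemma minimal_1_obstruction : min_spolar_obs 1 [set: G] -> spolar 2 [set: G].
Proof.
move=> mG; have nG : ~~ spolar 1 [set: G] by case/andP: mG.
have [] := foldes_hammer nG.
- move=> [a [b [c [d /and5P[ab cd ac ad /andP[bc bd]]]]]].
  have [[a_c a_d] [b_c b_d]] : (a != c /\ a != d) /\ (b != c /\ b != d).
    by split; split; neqs.
  have E : [set x in [:: a; b; c; d]] = [set: G].
    apply: (small_obstruction mG) => /spolar1_bits[f [hA hB]].
    have [aX bX cX dX] : [/\ a \in [set x in [:: a; b; c; d]],
        b \in [set x in [:: a; b; c; d]], c \in [set x in [:: a; b; c; d]] &
        d \in [set x in [:: a; b; c; d]]] by split; rewrite !inE eqxx ?orbT.
    have := (hA a b aX bX ab, hA c d cX dX cd).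
    have := (hB a c aX cX a_c ac, hB a d aX dX a_d ad, hB b c bX cX b_c bc,
      hB b d bX dX b_d bd).
    by case: (f a); case: (f b); case: (f c); case: (f d) => -[[[? ?] ?] ?] [? ?].
  have cover x : [|| x == a, x == b, x == c | x == d].
    by have : x \in [set: G] by []; rewrite -E !inE.
  apply: (@two_parts_polar _ [set a] [set b]).
  - by move=> x y /set1P-> /set1P->; rewrite adj_irrefl.
  - by move=> x y /set1P-> /set1P->; rewrite adj_irrefl.
  - by move=> x y /set1P-> /set1P->.
  move=> x y; rewrite !inE; have := cover x; have := cover y.
  case/or4P => /eqP->; rewrite ?eqxx // => /or4P[] /eqP->; rewrite ?eqxx //; by adjs.
- move=> [a [b [c [d /and5P[ab bc cd da /and4P[ac bd a_c b_d]]]]]].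
  have E : [set x in [:: a; b; c; d]] = [set: G].
    apply: (small_obstruction mG) => /spolar1_bits[f [hA hB]].
    have [aX bX cX dX] : [/\ a \in [set x in [:: a; b; c; d]],
        b \in [set x in [:: a; b; c; d]], c \in [set x in [:: a; b; c; d]] &
        d \in [set x in [:: a; b; c; d]]] by split; rewrite !inE eqxx ?orbT.
    have := (hA a b aX bX ab, hA b c bX cX bc, hA c d cX dX cd, hA d a dX aX da).
    have := (hB a c aX cX a_c ac, hB b d bX dX b_d bd).
    by case: (f a); case: (f b); case: (f c); case: (f d) => -[? ?] [[[? ?] ?] ?].
  have cover x : [|| x == a, x == b, x == c | x == d].
    by have : x \in [set: G] by []; rewrite -E !inE.
  apply: (@two_parts_polar _ [set a; c] [set b; d]).
  - by move=> x y /set2P[]-> /set2P[]->; adjs; rewrite ?adj_irrefl.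
  - by move=> x y /set2P[]-> /set2P[]->; adjs; rewrite ?adj_irrefl.
  - by move=> x y /set2P[]-> /set2P[]->; adjs.
  by move=> x y; rewrite !inE; have /or4P[] := cover x => /eqP->; rewrite ?eqxx ?orbT.
move=> [a [b [c [d [e /andP[/and5P[ab bc cd de ea] /and5P[ac ad bd be ce]]]]]]].
have ut : uniq [:: a; b; c; d; e] by all_neqs.
have E : [set x in [:: a; b; c; d; e]] = [set: G].
  apply: (small_obstruction mG) => /spolar1_bits[f [hA hB]].
  have mem x : x \in [:: a; b; c; d; e] -> x \in [set x in [:: a; b; c; d; e]].
    by rewrite in_set.
  have [aX bX cX] : [/\ a \in [set x in [:: a; b; c; d; e]],
     b \in [set x in [:: a; b; c; d; e]] & c \in [set x in [:: a; b; c; d; e]]].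
    by split; apply: mem; rewrite !inE eqxx ?orbT.
  have [dX eX] : d \in [set x in [:: a; b; c; d; e]] /\
      e \in [set x in [:: a; b; c; d; e]].
    by split; apply: mem; rewrite !inE eqxx ?orbT.
  have [[a_c a_d] [[b_d b_e] c_e]] : (a != c /\ a != d) /\ ((b != d /\ b != e) /\ c != e).
    by do !split; neqs.
  have := (hA a b aX bX ab, hA b c bX cX bc, hA c d cX dX cd, hA d e dX eX de,
    hA e a eX aX ea).
  have := (hB a c aX cX a_c ac, hB a d aX dX a_d ad, hB b d bX dX b_d bd,
    hB b e bX eX b_e be, hB c e cX eX c_e ce).
  by case: (f a); case: (f b); case: (f c); case: (f d); case: (f e) =>
    -[[[[? ?] ?] ?] ?] [[[[? ?] ?] ?] ?].
have cover x : [|| x == a, x == b, x == c, x == d | x == e].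
  by have : x \in [set: G] by []; rewrite -E !inE.
apply: (@two_parts_polar _ [set a; c] [set b]).
- by move=> x y /set2P[]-> /set2P[]->; adjs; rewrite ?adj_irrefl.
- by move=> x y /set1P-> /set1P->; rewrite adj_irrefl.
- by move=> x y /set2P[]-> /set1P->; adjs.
move=> x y; rewrite !inE => xac xb yac yb.
have de_ z : z \notin [set a; c] -> z != b -> (z == d) || (z == e).
  rewrite !inE negb_or => /andP[za zc] zb.
  by have := cover z; rewrite (negbTE za) (negbTE zb) (negbTE zc).
have := de_ x; have := de_ y; rewrite !inE => /(_ yac yb) + /(_ xac xb).
by move=> /orP[] /eqP-> /orP[] /eqP->; adjs; rewrite ?eqxx.
Qed.

Lemma minimal_0_obstruction : min_spolar_obs 0 [set: G] -> spolar 1 [set: G].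
Proof.
move=> mG; have nG : ~~ spolar 0 [set: G] by case/andP: mG.
have [cT|/forall_inPn[x _ /forall_inPn[y _]]] := boolP (clique [set: G]).
  case/negP: nG; apply/spolarP; exists (fun=> 0) => // x y _ _ _ _.
  by move/cliqueP: cT; apply.
rewrite negb_imply => /andP[x_y xy].
have E : [set x; y] = [set: G].
  apply: (small_obstruction mG) => /spolarP[f _ /(_ x y)].
  by rewrite !inE !eqxx orbT => /(_ isT isT isT isT x_y); apply/negP.
apply/spolarP; exists (fun=> 0) => // u v; rewrite -E => uE vE _ _.
by apply/negbTE; case/set2P: uE => ->; case/set2P: vE => ->; adjs; rewrite ?adj_irrefl.
Qed.

(** For at least two parts, co-connected obstructions that are connected do not exist, and the
    disconnected ones are sporadic or of a type in (2), which needs just one more part. *)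
Lemma minimal_obstruction_succ s : p4_class G -> p4_class (compl G) ->
  ~~ disc (compl G) -> min_spolar_obs s [set: G] ->
  sporadic G \/ spolar s.+1 [set: G].
Proof.
move=> cl ccl ccG; case: s => [|[|s]] mG.
- by right; apply: minimal_0_obstruction.
- by right; apply: minimal_1_obstruction.
have [dG|cG] := boolP (disc G); last first.
  by case: (@no_connected_obstruction G s.+2).
have [|] := disconnected_obstruction (isT : 2 <= s.+2) mG dG; first by left.
by case/disconnected_type_props => // _ _; right.
Qed.
End Threshold.

(** * Components of the complement *)

Section Components.
Variable H : sgraph.

Lemma adj_connect_sym : connect_sym (@adj H).
Proof. exact: sym_connect_sym (@adj_sym H). Qed.

Lemma connect_equivalence :
  {in [set: H] & &, equivalence_rel (connect (@adj H))}.
Proof.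
move=> x y z _ _ _; split=> [|xy]; first exact: connect0.
exact: (same_connect adj_connect_sym).
Qed.

Lemma components_partition : partition (components H) [set: H].
Proof. exact: equivalence_partitionP connect_equivalence. Qed.

Lemma component_exists x : exists2 D, D \in components H & x \in D.
Proof.
have xT : x \in cover (components H).
  by rewrite (cover_partition components_partition).
by exists (pblock (components H) x); [apply: pblock_mem|rewrite mem_pblock].
Qed.

Lemma component_eq D D' x : D \in components H -> D' \in components H ->
  x \in D -> x \in D' -> D = D'.
Proof.
have /and3P[_ tP _] := components_partition.
by move=> Dc D'c xD xD'; rewrite -(def_pblock tP Dc xD) -(def_pblock tP D'c xD').
Qed.

Lemma component_connect D x y : D \in components H -> x \in D ->
  (y \in D) = connect (@adj H) x y.
Proof.
have /and3P[_ tP _] := components_partition.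
move=> Dc xD; rewrite -(def_pblock tP Dc xD).
by rewrite (pblock_equivalence_partition connect_equivalence).
Qed.

Lemma component_neq0 D : D \in components H -> exists x, x \in D.
Proof.
have /and3P[_ _ n0] := components_partition => Dc; apply/set0Pn.
by apply: contraNneq n0 => <-.
Qed.

Lemma disc_components : disc H = (1 < #|components H|).
Proof.
apply/discP/card_gt1P => [[U [[x xU] [y yU] UU]]|[D [D' [Dc D'c DD']]]].
  have [[D Dc xD] [D' D'c yD']] := (component_exists x, component_exists y).
  exists D, D'; split=> //; apply/eqP => E; subst D'; move: yD'.
  rewrite (component_connect _ Dc xD) => /closed_connect-/(_ (mem U)).
  rewrite xU (negbTE yU) => h; suff : true = false by [].
  apply: h; apply: (intro_closed adj_connect_sym) => u v uv uU.
  by apply/negPn/negP => vU; have := UU u v uU vU; rewrite uv.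
have [[x xD] [y yD']] := (component_neq0 Dc, component_neq0 D'c).
exists D; split; [by exists x|exists y|].
  by apply/negP => yD; case/eqP: DD'; apply: component_eq yD yD'.
move=> u v uD; rewrite (component_connect _ Dc uD).
by apply: contra; apply: connect1.
Qed.

Lemma component_conn D : D \in components H -> ~~ disc (induced D).
Proof.
move=> Dc; apply/negP => /discP[U [[x xU] [y yU] UU]].
pose V := [set val u | u in U].
have xV : val x \in V by apply: imset_f.
suff clV : closed (@adj H) (mem V).
  have xy : connect (@adj H) (val x) (val y).
    by rewrite -(component_connect _ Dc (valP x)) (valP y).
  have : val y \in mem V by rewrite -(closed_connect clV xy).
  by case/imsetP => z zU /val_inj E; move: yU; rewrite E zU.
apply: (intro_closed adj_connect_sym) => u v uv /imsetP[z zU Eu]; subst u.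
have vD : v \in D.
  by rewrite (component_connect _ Dc (valP z)) connect1.
have [vU|vU] := boolP ((exist _ v vD : induced D) \in U).
  by apply/imsetP; exists (exist _ v vD).
by have := UU _ _ zU vU; rewrite /= /induced_adj /= uv.
Qed.
End Components.

Lemma disc_compl2 (G : sgraph) : disc (compl (compl G)) -> disc G.
Proof.
apply: giso_disc; exists id => [|x y]; first by exists id.
rewrite !compl_adjE; case: eqP => [->|] /=; first by rewrite adj_irrefl.
by rewrite negbK.
Qed.

(** * Additivity of the number of parts over co-components *)

Section Additivity.
Variable G : sgraph.
Implicit Types (x y : G) (A W D : {set G}).

Notation comps := (components (compl G) : {set {set G}}).

Lemma across_adj D x y : D \in comps -> x \in D -> y \notin D -> adj x y.
Proof.
move=> Dc xD; rewrite (@component_connect (compl G) D x y Dc xD); apply: contraR => xy.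
have [->|x_y] := eqVneq x y; first exact: connect0.
by apply: connect1; rewrite compl_adjE x_y.
Qed.

Lemma nonnbrs_component A D x : D \in comps -> x \in D ->
  nonnbrs A x = nonnbrs (A :&: D) x.
Proof.
move=> Dc xD; apply/setP => y; rewrite !mem_nonnbrs !inE.
have [yD|yD] := boolP (y \in D); first by rewrite andbT.
by rewrite (across_adj Dc xD yD) !andbF.
Qed.

(** Vertices of different co-components are adjacent in [G], so no part meets two of them. *)
Lemma nparts_components A : nparts A = \sum_(D in comps) nparts (A :&: D).
Proof.
(* Empty outside [comps], so that the family is disjoint over all sets. *)
pose F (D : {set G}) := if D \in comps then nonnbrs A @: (A :&: D) else set0.
have FE D : D \in comps -> #|F D| = nparts (A :&: D).
  move=> Dc; rewrite /F Dc /nparts; apply: eq_card => K.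
  apply/imsetP/imsetP => -[x xAD ->]; exists x => //; case/setIP: xAD => _ xD.
    by rewrite (nonnbrs_component A Dc xD).
  by rewrite (nonnbrs_component A Dc xD).
have dF D D' : D != D' -> [disjoint F D & F D'].
  move=> DD'; rewrite /F; case: ifP => Dc; last by rewrite disjoints_subset sub0set.
  case: ifP => D'c; last by rewrite disjoint_sym disjoints_subset sub0set.
  rewrite -setI_eq0; apply/eqP/setP => K; rewrite in_setI in_set0.
  apply/negP => /andP[/imsetP[x /setIP[xA xD] ->] /imsetP[y /setIP[yA yD'] E]].
  have : x \in nonnbrs A y by rewrite -E mem_nonnbrs xA adj_irrefl.
  rewrite mem_nonnbrs xA adj_sym (across_adj Dc xD) //.
  by apply/negP => yD; case/eqP: DD'; apply: (@component_eq (compl G) _ _ y).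
transitivity #|\bigcup_D F D|.
  apply: eq_card => K; apply/imsetP/bigcupP => [[x xA ->]|[D _]].
    have [D Dc xD] := component_exists (x : compl G).
    by exists D => //; rewrite /F Dc; apply: imset_f; rewrite inE xA.
  rewrite /F; case: ifP => [Dc|]; last by rewrite in_set0.
  by case/imsetP => x /setIP[xA _] ->; exists x.
rewrite -sum1_card (partition_disjoint_bigcup _ _ dF) (bigID (mem comps)) /=.
rewrite [X in _ + X]big1 ?addn0.
  by apply: eq_bigr => D Dc; rewrite sum1_card FE.
by move=> D Dc; rewrite /F (negbTE Dc) big_set0.
Qed.

(** Distinct co-components are completely joined: the union of cliques is a clique, and the union of
    multipartite sets is multipartite with the parts added. *)
Lemma spolar_components s W : spolar s W <->
  exists2 sigma : {set G} -> nat, \sum_(D in comps) sigma D <= s &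
    forall D, D \in comps -> spolar (sigma D) (W :&: D).
Proof.
split=> [/existsP[A /and4P[/subsetP AW /multipartiteP mA pA /cliqueP cA]]|].
  exists (fun D => nparts (A :&: D)); first by rewrite -nparts_components.
  move=> D Dc; apply/existsP; exists (A :&: D); apply/and4P; split=> //.
  - by apply/subsetP => x /setIP[xA xD]; rewrite inE xD AW.
  - apply/multipartiteP => x y z /setIP[xA _] /setIP[yA _] /setIP[zA _].
    exact: mA.
  apply/cliqueP => x y; rewrite !inE => /andP[xA /andP[xW xD]] /andP[yA /andP[yW yD]].
  move: xA yA; rewrite xD yD !andbT => xA yA.
  by apply: cA; rewrite inE ?xA ?yA.
case=> sigma sum_s pD.
pose AD D := odflt set0 [pick A : {set G} | [&& A \subset W :&: D, multipartite A,
  nparts A <= sigma D & clique (W :&: D :\: A)]].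
have ADP D : D \in comps -> [&& AD D \subset W :&: D, multipartite (AD D),
    nparts (AD D) <= sigma D & clique (W :&: D :\: AD D)].
  move=> Dc; rewrite /AD; case: pickP => [A //|none].
  by case/existsP: (pD D Dc) => A; rewrite none.
pose A := \bigcup_(D in comps) AD D.
have AI D : D \in comps -> A :&: D = AD D.
  move=> Dc; apply/setP => x; rewrite inE; apply/andP/idP => [[/bigcupP[D' D'c xA] xD]|xA].
    suff -> : D = D' by [].
    apply: (@component_eq (compl G) _ _ x Dc D'c xD).
    by have /and4P[/subsetP/(_ x xA)/setIP[]] := ADP D' D'c.
  split; first by apply/bigcupP; exists D.
  by have /and4P[/subsetP/(_ x xA)/setIP[]] := ADP D Dc.
apply/existsP; exists A; apply/and4P; split.
- apply/bigcupsP => D Dc; have /and4P[sD _ _ _] := ADP D Dc.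
  exact: subset_trans sD (subsetIl _ _).
- apply/multipartiteP => x y z xA yA zA xz; apply: contraT; rewrite negb_or.
  case/andP=> xy yz; have [D Dc xD] := component_exists (x : compl G).
  have yD : y \in D by apply: contraR xy; apply: across_adj.
  have zD : z \in D by apply: contraR yz; apply: across_adj.
  have /and4P[_ /multipartiteP mD _ _] := ADP D Dc.
  have := mD x y z; rewrite -AI // !inE xA yA zA xD yD zD (negbTE xy) (negbTE yz).
  by move=> /(_ isT isT isT xz).
- rewrite nparts_components; apply: leq_trans sum_s; apply: leq_sum => D Dc.
  by rewrite AI //; case/and4P: (ADP D Dc).
apply/cliqueP => x y; rewrite !inE => /andP[xA xW] /andP[yA yW] x_y.
have [D Dc xD] := component_exists (x : compl G).
have [yD|yD] := boolP (y \in D); last exact: across_adj xD yD.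
have /and4P[_ _ _ /cliqueP cD] := ADP D Dc.
by apply: cD; rewrite // -AI // !inE ?xD ?yD ?xW ?yW ?andbT.
Qed.
End Additivity.

Lemma closed_class_component (C : graph_class) (G : sgraph) (D : {set G}) :
  compl_closed C -> induced_closed C -> C G -> C (compl (@induced (compl G) D)).
Proof. by move=> hc hi hG; apply/hc/hi/hc. Qed.

(** * Assertion (3) *)

Section JoinType.
Variables (G : sgraph) (s : nat).

Notation comps := (components (compl G) : {set {set G}}).
Notation piece D := (compl (@induced (compl G) D)).

Hypothesis cl : forall D : {set G}, p4_class (piece D) /\ p4_class (compl (piece D)).

Lemma piece_succ (D : {set G}) k : D \in comps -> min_spolar_obs k D ->
  sporadic (piece D) \/ spolar k.+1 D.
Proof.
move=> Dc mD; have [c1 c2] := cl D.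
rewrite -spolar_compl_induced; apply: minimal_obstruction_succ => //.
  by apply: contra (@component_conn (compl G) D Dc); apply: disc_compl2.
by rewrite min_spolar_obs_compl_induced.
Qed.

Lemma obstruction_join_type : disc (compl G) -> min_spolar_obs s [set: G] ->
  join_type s G.
Proof.
rewrite disc_components => gt1 mG; split=> //; have [nG _] := min_spolar_obsP _ _ mG.
have dG v : spolar s ([set: G] :\ v) by case/andP: mG => _ /forall_inP; apply; rewrite inE.
(* Deleting a vertex of another co-component leaves [D] intact inside a polar graph. *)
have pD D : D \in comps -> exists k, spolar k D.
  move=> Dc; have /card_gt1P[D1 [D2 [D1c D2c D12]]] := gt1.
  have [D' D'c DD'] : exists2 D', D' \in comps & D' != D.
    by have [E|] := eqVneq D1 D; [exists D2; rewrite // -E eq_sym|exists D1].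
  have [v vD'] := @component_neq0 (compl G) _ D'c.
  have [sigma _ /(_ D Dc) h] := (spolar_components s _).1 (dG v).
  exists (sigma D); apply: spolar_sub h; apply/subsetP => x xD; rewrite !inE xD !andbT.
  apply: contraNneq DD' => E; subst x.
  by rewrite (@component_eq (compl G) _ _ _ D'c Dc vD' xD).
(* [c D] is the least number of parts for [D]; 0 is a dummy value for sets that are not
   co-components. *)
have /fin_all_exists[c cP] : forall D : {set G}, exists k, D \in comps ->
    spolar k D /\ forall j, spolar j D -> k <= j.
  move=> D; have [Dc|] := boolP (D \in comps); last by exists 0.
  by case: (ex_minnP (pD D Dc)) => k pk mk; exists k.
have c_sum : s < \sum_(D in comps) c D.
  rewrite ltnNge; apply/negP => le; apply: nG; apply/spolar_components; exists c => //.
  by move=> D Dc; rewrite setTI; case: (cP D Dc).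
have rest D v : D \in comps -> v \in D -> exists2 k, spolar k (D :\ v) &
    k + \sum_(D' in comps | D' != D) c D' <= s.
  move=> Dc vD; have [sigma le h] := (spolar_components s _).1 (dG v).
  exists (sigma D); first by have := h D Dc; rewrite setIDAC setTI.
  apply: leq_trans le; rewrite [X in _ <= X](bigD1 D) //= leq_add2l.
  apply: leq_sum => D' /andP[D'c ne].
  have [_ mc] := cP D' D'c; apply: mc; apply: spolar_sub (h D' D'c).
  apply/subsetP => x xD'; rewrite !inE xD' !andbT.
  by apply: contraNneq ne => E; subst x; rewrite (@component_eq (compl G) _ _ _ Dc D'c vD xD').
(* What remains of [s] for [D] when the others get their least values: too little for [D], but
   enough for [D] without any one vertex. By [rest] the subtraction is not truncated. *)
pose sigma D := s - \sum_(D' in comps | D' != D) c D'.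
have sigmaP D : D \in comps -> [/\ min_spolar_obs (sigma D) D, ~ sporadic (piece D) &
    c D = (sigma D).+1].
  move=> Dc; have [v0 v0D] := @component_neq0 (compl G) _ Dc.
  have sD : \sum_(D' in comps | D' != D) c D' <= s.
    by have [k _] := rest D v0 Dc v0D; apply: leq_trans; apply: leq_addl.
  have [pcD mcD] := cP D Dc.
  have lt : sigma D < c D.
    by rewrite ltn_subLR // addnC; move: c_sum; rewrite (bigD1 D).
  have mD : min_spolar_obs (sigma D) D.
    apply/andP; split; first by apply/negP => /mcD; rewrite leqNgt lt.
    apply/forall_inP => v vD; have [k pk le] := rest D v Dc vD.
    by apply: spolar_leq pk; rewrite leq_subRL // addnC.
  have nsp : ~ sporadic (piece D).
    by case/sporadic_universal => /(_ (c D)) + _; apply; rewrite spolar_compl_induced.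
  (* [D] needs more than [sigma D] parts and, not being sporadic, at most one more. *)
  split=> //; have [//|/mcD le] := piece_succ Dc mD.
  by apply/eqP; rewrite eqn_leq le lt.
exists sigma; split=> [D Dc|].
  have [mD nsp _] := sigmaP D Dc; split=> //.
  by apply/min_polar_obstruction_compl; rewrite min_spolar_obs_compl_induced.
have [D0 D0c] : exists D, D \in comps by apply/card_gt0P; apply: ltnW.
have E : s.+1 = \sum_(D in comps) c D.
  have [_ _ c0] := sigmaP D0 D0c.
  have [v0 v0D] := @component_neq0 (compl G) _ D0c; have [k _ le] := rest D0 v0 D0c v0D.
  rewrite (bigD1 D0) //= c0 addSn subnK //.
  exact: leq_trans (leq_addl _ _) le.
have : \sum_(D in comps) c D = \sum_(D in comps) sigma D + #|comps|.
  rewrite -sum1_card -big_split /=; apply: eq_bigr => D Dc.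
  by have [_ _ ->] := sigmaP D Dc; rewrite addn1.
rewrite -E => e; apply: (@addIn 1).
by rewrite addn1 e addnAC subnK ?(ltnW gt1) // addnC.
Qed.

(** The least value of [D] is [sigma D + 1], so [G] needs [s + 1] parts in total, and deleting a
    vertex of [D] saves one of them. *)
Lemma join_type_obstruction : join_type s G -> min_spolar_obs s [set: G].
Proof.
case=> gt1 [sigma [hs s_eq]].
have hD D : D \in comps -> [/\ min_spolar_obs (sigma D) D, spolar (sigma D).+1 D &
    forall k, spolar k D -> sigma D < k].
  move=> Dc; have [mD nsp] := hs D Dc.
  move: mD; rewrite min_polar_obstruction_compl min_spolar_obs_compl_induced => mD.
  split=> //; first by have [/nsp|] := piece_succ Dc mD.
  move=> k pk; rewrite ltnNge; apply/negP => le.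
  by case/andP: mD => /negP nD _; apply: nD; apply: spolar_leq pk.
have sum_succ : \sum_(D in comps) (sigma D).+1 = s.+1.
  under eq_bigr do rewrite -addn1; rewrite big_split /= sum1_card s_eq.
  by rewrite addnC -addSn -(addn1 (_ - 1)) subnK // ltnW.
apply/andP; split.
  apply/negP => /spolar_components[tau le h]; suff : s < s by rewrite ltnn.
  apply: leq_trans le; rewrite -sum_succ; apply: leq_sum => D Dc.
  by have [_ _ m] := hD D Dc; apply: m; have := h D Dc; rewrite setTI.
apply/forall_inP => v _; have [D Dc vD] := component_exists (v : compl G).
apply/spolar_components; exists (fun D' => if D' == D then sigma D else (sigma D').+1).
  rewrite -ltnS -sum_succ (bigD1 D) //= [X in _ < X](bigD1 D) //= eqxx ltnS leq_add2l.
  by apply: leq_sum => D' /andP[_ /negbTE->].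
move=> D' D'c; rewrite setIDAC setTI; have [mD' pD' _] := hD D' D'c.
case: eqP => [E|_]; last exact: spolar_sub (subsetDl _ _) pD'.
by subst D'; case/andP: mD' => _ /forall_inP; apply.
Qed.
End JoinType.

Theorem theorem53 (C : graph_class)
  (hiso : iso_closed C)
  (hP4 : (forall H : sgraph, C H -> P4_extendible H) \/
         (forall H : sgraph, C H -> P4_sparse H))
  (hcompl : compl_closed C)
  (hind : induced_closed C)
  (G : sgraph) (hG : C G) (s : nat) (hs : 2 <= s) :
  min_polar_obstruction s 1 G <->
  exactly_one (sporadic G) (disconnected_type s G) (join_type s G).
Proof.
have cl H : C H -> p4_class H.
  by move=> CH; case: hP4 => h; [left|right]; apply: h.
have clD (D : {set G}) : p4_class (compl (@induced (compl G) D)) /\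
    p4_class (compl (compl (@induced (compl G) D))).
  by have CD := closed_class_component D hcompl hind hG; split; apply: cl => //; apply: hcompl.
(* Pairs across a disconnection of [G] are adjacent in the complement, which is therefore
   connected. *)
have disj : disc G -> ~ join_type s G.
  case/discP => U [[x xU] [y yU] UU] [+ _]; rewrite -disc_components.
  case/discP => V [[u uV] [v vV] VV].
  have sep z w : z \in U -> w \notin U -> (z \in V) = (w \in V).
    move=> zU wU; have zw : @adj (compl G) z w.
      by rewrite compl_adjE UU // andbT; apply: contraNneq wU => <-.
    apply/idP/idP => [zV|wV]; apply/negPn/negP => nV.
      by have := VV _ _ zV nV; rewrite zw.
    by have := VV _ _ wV nV; rewrite adj_sym zw.
  have all z : (z \in V) = (x \in V).
    have [zU|zU] := boolP (z \in U); last by rewrite (sep x z).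
    by rewrite (sep z y) // (sep x y).
  by rewrite all -(all u) uV in vV.
(* A sporadic graph is polar for no number of parts, whereas those in (2) are (s+1,1)-polar. *)
have noboth : ~ (sporadic G /\ disconnected_type s G).
  case=> /sporadic_universal[nG _] /(disconnected_type_props hs)[_ _ pG].
  exact: nG pG.
rewrite min_polar_obstructionP; split=> [mG|[[]]].
- split=> //; first last.
  + by case=> /(disconnected_type_props hs)[dG _ _]; apply: disj.
  + by case=> /sporadic_disc; apply: disj.
  have [dG|cG] := boolP (disc G).
    by case: (disconnected_obstruction hs mG dG); [constructor 1|constructor 2].
  have [dcG|ccG] := boolP (disc (compl G)).
    by constructor 3; apply: obstruction_join_type.
  by case: (@no_connected_obstruction G s) => //; apply: cl => //; apply: hcompl.
- by move=> /sporadic_universal[_ mG] _ _ _; apply: mG.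
- by move=> /(disconnected_type_props hs)[].
by move=> h _ _ _; apply: join_type_obstruction.
Qed.
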